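(* Let $\nu\ge1$ and let $c_1,\dots,c_\nu\in[0,1]$ be pairwise distinct. For each $n$, let $\alpha_{0,n},\dots,\alpha_{\nu-1,n}\in X$ be the unique coefficients satisfying the interpolation conditions $$\sum_{j=0}^{\nu-1}\alpha_{j,n}(t_n+c_i\tau)^{jr}=h\bigl((t_n+c_i\tau)^r\bigr),\qquad i=1,\dots,\nu,$$ and consider the scheme (EQRF$\nu$) $$y_{n+1}=e^{\tau A}y_n+\tau\varphi_1(\tau A)\alpha_{0,n}+\sum_{j=1}^{\nu-1}\Gamma(1+jr)\Bigl((t_n+\tau)^{1+jr}\varphi_{1+jr}\bigl((t_n+\tau)A\bigr)-t_n^{1+jr}e^{\tau A}\varphi_{1+jr}(t_nA)\Bigr)\alpha_{j,n},$$ $n=0,\dots,N-1$, started from the exact initial value $y_0$. Let $\epsilon_n=y(t_n)-y_n$. Then: \begin{enumerate} \item if $h$ is $\nu$ times differentiable on $[0,\infty)$ with bounded derivatives $h',\dots,h^{(\nu)}$, then $$\|\epsilon_n\|\le\begin{cases}C\tau^{\min\{1+\nu r,\,\nu\}}, & r\neq\frac{\nu-1}{\nu},\\ C\tau^{\nu}\bigl(1+\lvert\log\tau\rvert\bigr), & r=\frac{\nu-1}{\nu};\end{cases}$$ \item if $h$ is $\nu+1$ times differentiable on $[0,\infty)$ with bounded derivatives $h',\dots,h^{(\nu+1)}$, if $h^{(\nu)}(x)\in\mathcal{D}(A)$ for all $x\ge0$ with $x\mapsto Ah^{(\nu)}(x)$ bounded, and if the points satisfy $$\int_0^1(s-c_1)\cdots(s-c_\nu)\,ds=\frac{1}{\nu+1}-\frac{c_1+\cdots+c_\nu}{\nu}+\sum_{i<j}\frac{c_ic_j}{\nu-1}-\sum_{i<j<k}\frac{c_ic_jc_k}{\nu-2}+\cdots+(-1)^\nu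 c_1\cdots c_\nu=0,$$ then $\|\epsilon_n\|\le C\tau^{1+\nu r}$. \end{enumerate} The bounds hold for all $N\in\mathbb{N}$ and $0\le n\le N$, with $C$ possibly depending on $T$ (and on $r,\nu,h,c_1,\dots,c_\nu$ and the semigroup) but not on $n$ or $\tau$.
   Context: $(X,\|\cdot\|)$ is a Banach space and $A:\mathcal{D}(A)\subset X\to X$ is a linear operator generating a strongly continuous semigroup $\{e^{tA}\}_{t\ge0}$ on $X$. Fix $T>0$, $0<r<1$, $y_0\in X$ and $h:[0,\infty)\to X$. The problem is $y'(t)=Ay(t)+h(t^r)$, $y(0)=y_0$, $t\in[0,T]$, with (mild) solution $y(t)=e^{tA}y_0+\int_0^te^{(t-s)A}h(s^r)\,ds$. Time grid: $N\in\mathbb{N}$, $\tau=T/N$, $t_n=n\tau$. For $\lambda>0$ and $t\ge0$ the fractional $\varphi$ function is the bounded operator $\varphi_\lambda(tA)v=\frac{1}{\Gamma(\lambda)}\int_0^1e^{(1-\theta)tA}\theta^{\lambda-1}v\,d\theta$ ($v\in X$), $\Gamma$ being Euler's gamma function; in particular $\tau\varphi_1(\tau A)v=\int_0^\tau e^{(\tau-s)A}v\,ds$. Convention $0^{1+jr}=0$. *)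

(* Defs.v *)
From Stdlib Require Import Reals Lra.
From Coquelicot Require Import Coquelicot.
Open Scope R_scope.

Definition rpow (x a : R) : R :=
  if Rlt_dec 0 x then Rpower x a else if Req_EM_T a 0 then 1 else 0.

Definition Gamma (x : R) : R :=
  RInt_gen (fun t => rpow t (x - 1) * exp (- t)) (at_right 0) (Rbar_locally p_infty).

Section Banach.
Context {X : CompleteNormedModule R_AbsRing}.

Fixpoint vsum (f : nat -> X) (n : nat) : X :=
  match n with O => zero | S k => plus (vsum f k) (f k) end.

Definition C0_semigroup (E : R -> X -> X) : Prop :=
  (forall t, 0 <= t -> forall u v, E t (plus u v) = plus (E t u) (E t v)) /\
  (forall t, 0 <= t -> forall (a : R) v, E t (scal a v) = scal a (E t v)) /\
  (forall t, 0 <= t -> exists M, forall v, norm (E t v) <= M * norm v) /\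
  (forall v, E 0 v = v) /\
  (forall t s, 0 <= t -> 0 <= s -> forall v, E (t + s) v = E t (E s v)) /\
  (forall v, filterlim (fun t => E t v) (at_right 0) (locally v)).

Definition generator (E : R -> X -> X) (DA : X -> Prop) (A : X -> X) : Prop :=
  (forall v, DA v <-> exists w,
     filterlim (fun t => scal (/ t) (minus (E t v) v)) (at_right 0) (locally w)) /\
  (forall v, DA v ->
     filterlim (fun t => scal (/ t) (minus (E t v) v)) (at_right 0) (locally (A v))).

Definition phi (E : R -> X -> X) (lam t : R) (v : X) : X :=
  scal (/ Gamma lam) (RInt (fun th => scal (rpow th (lam - 1)) (E ((1 - th) * t) v)) 0 1).

Definition deriv_on_nonneg (f : R -> X) (x : R) (d : X) : Prop :=
  filterlim (fun y => scal (/ (y - x)) (minus (f y) (f x)))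
    (within (fun y => 0 <= y /\ y <> x) (locally x)) (locally d).

Definition derivs_bdd (h : R -> X) (m : nat) (hd : nat -> R -> X) : Prop :=
  (forall x, 0 <= x -> hd O x = h x) /\
  (forall k x, (k < m)%nat -> 0 <= x -> deriv_on_nonneg (hd k) x (hd (S k) x)) /\
  (forall k, (1 <= k <= m)%nat -> exists M, forall x, 0 <= x -> norm (hd k x) <= M).

Definition mild_sol (E : R -> X -> X) (h : R -> X) (r : R) (y0 : X) (t : R) : X :=
  plus (E t y0) (RInt (fun s => E (t - s) (h (rpow s r))) 0 t).

Definition interp_coeffs (h : R -> X) (r : R) (nu : nat) (c : nat -> R) (tau : R)
    (alpha : nat -> nat -> X) (N : nat) : Prop :=
  forall n i, (n < N)%nat -> (i < nu)%nat ->
    vsum (fun j => scal (rpow (INR n * tau + c i * tau) (INR j * r)) (alpha j n)) nu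
    = h (rpow (INR n * tau + c i * tau) r).

Fixpoint EQRF (E : R -> X -> X) (r : R) (nu : nat) (tau : R) (y0 : X)
    (alpha : nat -> nat -> X) (n : nat) : X :=
  match n with
  | O => y0
  | S m =>
    let tn := INR m * tau in
    plus (plus (E tau (EQRF E r nu tau y0 alpha m)) (scal tau (phi E 1 tau (alpha O m))))
      (vsum (fun j0 =>
         let j := S j0 in
         let lam := 1 + INR j * r in
         scal (Gamma lam)
           (minus (scal (rpow (tn + tau) lam) (phi E lam (tn + tau) (alpha j m)))
                  (scal (rpow tn lam) (E tau (phi E lam tn (alpha j m))))))
       (nu - 1))
  end.

End Banach.

(* Main.v *)
Require Import Defs.
From Stdlib Require Import Reals List Lra Lia Arith Classical ClassicalEpsilon.
From Coquelicot Require Import Coquelicot.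
Open Scope R_scope.

(** The Gamma factors cancel, so that one step of the scheme is the variation-of-constants formula
    with [h(s^r)] replaced by [p_m(s^r)], where [p_m] interpolates [h] at the points
    [x_i = (t_m + c_i tau)^r].  Hence the error is bounded by the sum of the local defects
    [int E(t_{m+1} - s) (h(s^r) - p_m(s^r)) ds], up to the bound of the semigroup on [[0, T]].

    Interpolation on an interval of length [D] costs [sup |h^(nu)| D^nu], and the interval
    [[t_m^r, t_{m+1}^r]] has length [tau^r] for [m = 0] and at most
    [r t_m^(r-1) tau <= m^(r-1) tau^r] for [m >= 1].  So the defects are of order
    [tau^(1 + nu r) m^(-(1-r) nu)], and summing them gives the three regimes of part 1.

    For part 2, one further derivative isolates the leading term
    [h^(nu)(t_m^r) / nu! * prod_i (s^r - x_i)] of the interpolation error.  The semigroup moves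
    [h^(nu)(t_m^r)], an element of [D(A)], by [O(tau)]; linearizing [s^r] at [t_m] turns the product
    into a multiple of [prod_i (sigma - c_i)], of zero mean, with relative error [1/m].  This gains
    a factor [1/m], which makes the sum over [m] converge. *)

(** * Vectors of a complete normed module *)

Section ModuleReflection.
Context {V : ModuleSpace R_Ring}.

(** The working variable is y = s^r: in it the forcing is smooth and the interpolant is an ordinary
    polynomial, so the singularity at 0 enters only through the lengths of the intervals
    [t_m^r, t_{m+1}^r]. The first step is kept apart because s^r has no derivative at 0; its defect
    already has order 1 + nu r, so part 2 needs no gain there.

    The obstacle is the interpolation error. The estimate therefore never integrates h^(nu): it
    divides out the nodes one at a time through averages of lower derivatives, and h^(nu) acts only
    as a Lipschitz bound for h^(nu-1). This loses the factor 1/nu!, which C absorbs.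

    With q = (1-r) nu, part 1 sums m^(-q), where q = 1 is the critical case r = (nu-1)/nu, and part
    2 sums m^(-q-1), which converges because q > 0. *)

Inductive vexp :=
  | VAtom (n : nat) | VZero | VPlus (a b : vexp) | VOpp (a : vexp) | VScal (k : R) (a : vexp).

Fixpoint veval (env : list V) (e : vexp) : V :=
  match e with
  | VAtom n => nth n env zero
  | VZero => zero
  | VPlus a b => plus (veval env a) (veval env b)
  | VOpp a => opp (veval env a)
  | VScal k a => scal k (veval env a)
  end.

Fixpoint vcoef (e : vexp) (i : nat) : R :=
  match e with
  | VAtom n => if Nat.eqb n i then 1 else 0
  | VZero => 0
  | VPlus a b => vcoef a i + vcoef b i
  | VOpp a => - vcoef a i
  | VScal k a => k * vcoef a i
  end.

Fixpoint lincomb (env : list V) (f : nat -> R) : V :=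
  match env with
  | nil => zero
  | v :: l => plus (scal (f O) v) (lincomb l (fun i => f (S i)))
  end.

Fixpoint coef_eq (n : nat) (f g : nat -> R) : Prop :=
  match n with
  | O => True
  | S m => f O = g O /\ coef_eq m (fun i => f (S i)) (fun i => g (S i))
  end.

Lemma lincomb_eq env : forall f g, coef_eq (length env) f g -> lincomb env f = lincomb env g.
Proof.
  induction env as [|v l IH]; simpl; intros f g; trivial.
  intros [H0 H]; rewrite H0, (IH _ _ H); reflexivity.
Qed.

Lemma lincomb_zero env : forall f, (forall i, f i = 0) -> lincomb env f = zero.
Proof.
  induction env as [|v l IH]; simpl; intros f Hf; trivial.
  rewrite Hf, IH by (intros; apply Hf).
  etransitivity; [apply plus_zero_r|]. apply (scal_zero_l (K := R_Ring)).
Qed.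

Lemma lincomb_plus env : forall f g,
  lincomb env (fun i => f i + g i) = plus (lincomb env f) (lincomb env g).
Proof.
  induction env as [|v l IH]; simpl; intros f g.
  - symmetry; apply plus_zero_r.
  - rewrite (IH (fun i => f (S i)) (fun i => g (S i))).
    etransitivity; [apply (f_equal (fun z => plus z _)); apply (scal_distr_r (K := R_Ring))|].
    rewrite <- !plus_assoc; f_equal. rewrite !plus_assoc; f_equal. apply plus_comm.
Qed.

Lemma lincomb_scal env : forall k f,
  lincomb env (fun i => k * f i) = scal k (lincomb env f).
Proof.
  induction env as [|v l IH]; simpl; intros k f.
  - symmetry; apply (scal_zero_r (K := R_Ring)).
  - rewrite (IH k (fun i => f (S i))), scal_distr_l, scal_assoc; reflexivity.
Qed.

Lemma lincomb_atom env : forall n,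
  lincomb env (fun i => if Nat.eqb n i then 1 else 0) = nth n env zero.
Proof.
  induction env as [|v l IH]; intros [|n]; simpl; trivial.
  - rewrite lincomb_zero by trivial. rewrite plus_zero_r. apply (scal_one (K := R_Ring)).
  - rewrite IH. etransitivity; [|apply plus_zero_l]. f_equal. apply (scal_zero_l (K := R_Ring)).
Qed.

Lemma veval_lincomb env e : veval env e = lincomb env (vcoef e).
Proof.
  induction e; simpl.
  - symmetry; apply lincomb_atom.
  - symmetry; apply lincomb_zero; trivial.
  - rewrite lincomb_plus, IHe1, IHe2; reflexivity.
  - rewrite IHe, <- (scal_opp_one (K := R_Ring)), <- lincomb_scal.
    apply f_equal. apply FunctionalExtensionality.functional_extensionality; intros i.
    unfold opp, one; simpl. ring.
  - rewrite lincomb_scal, IHe; reflexivity.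
Qed.

(** Reflection principle: a vector identity follows once each atom has the same real coefficient on
    both sides, and these scalar equalities are goals for [ring] or [field]. *)
Lemma veval_eq env e1 e2 :
  coef_eq (length env) (vcoef e1) (vcoef e2) -> veval env e1 = veval env e2.
Proof. intros H; rewrite !veval_lincomb; apply lincomb_eq, H. Qed.

End ModuleReflection.

Ltac v_mem a l :=
  lazymatch l with
  | nil => constr:(false)
  | a :: _ => constr:(true)
  | _ :: ?l' => v_mem a l'
  end.
Ltac v_idx a l :=
  lazymatch l with
  | a :: _ => constr:(O)
  | _ :: ?l' => let n := v_idx a l' in constr:(S n)
  end.
Ltac v_atoms e l :=
  lazymatch e with
  | plus ?a ?b => let l := v_atoms a l in v_atoms b l
  | minus ?a ?b => let l := v_atoms a l in v_atoms b l
  | opp ?a => v_atoms a l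
  | scal _ ?a => v_atoms a l
  | zero => l
  | _ => lazymatch v_mem e l with true => l | false => constr:(cons e l) end
  end.
Ltac v_reify e l :=
  lazymatch e with
  | plus ?a ?b => let a := v_reify a l in let b := v_reify b l in constr:(VPlus a b)
  | minus ?a ?b => let a := v_reify a l in let b := v_reify b l in constr:(VPlus a (VOpp b))
  | opp ?a => let a := v_reify a l in constr:(VOpp a)
  | scal ?k ?a => let a := v_reify a l in constr:(VScal k a)
  | zero => constr:(VZero)
  | _ => let n := v_idx e l in constr:(VAtom n)
  end.
Ltac vnorm :=
  lazymatch goal with
  | |- @eq ?T ?a ?b =>
    let l := v_atoms a (@nil T) in
    let l := v_atoms b l in
    let ea := v_reify a l in
    let eb := v_reify b l in
    apply (veval_eq l ea eb);
    cbn [coef_eq vcoef length Nat.eqb]; repeat split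
  end.
Ltac vring := vnorm; try ring.
Ltac vfield := vnorm; try (field; auto).

(* Coquelicot reaches the operations of a complete normed module through several convertible
   coercion paths, which [rewrite] tells apart; this settles on a single one. *)
Ltac vcanon X :=
  let Z := constr:(CompleteNormedModule.AbelianGroup R_AbsRing X) in
  let P := constr:(CompleteNormedModule.AbelianMonoid R_AbsRing X) in
  let S := constr:(CompleteNormedModule.ModuleSpace R_AbsRing X) in
  let N := constr:(CompleteNormedModule.NormedModule R_AbsRing X) in
  repeat match goal with
  | |- context [@minus ?G ?a ?b] => tryif constr_eq G Z then fail else change (@minus G a b) with (@minus Z a b)
  | |- context [@opp ?G ?a] => tryif constr_eq G Z then fail else change (@opp G a) with (@opp Z a)
  | |- context [@plus ?G ?a ?b] => tryif constr_eq G P then fail else change (@plus G a b) with (@plus P a b)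
  | |- context [@zero ?G] => tryif constr_eq G P then fail else change (@zero G) with (@zero P)
  | |- context [@scal ?K ?M ?a ?v] => tryif (constr_eq K R_Ring; constr_eq M S) then fail
      else change (@scal K M a v) with (@scal R_Ring S a v)
  | |- context [@norm ?K ?M ?v] => tryif (constr_eq K R_AbsRing; constr_eq M N) then fail
      else change (@norm K M v) with (@norm R_AbsRing N v)
  end.

Ltac norm_as B :=
  lazymatch goal with
  | |- Rle (@norm ?K ?M ?A) _ =>
    let H := fresh in assert (H : A = B); [|rewrite H; clear H;
      lazymatch M with CompleteNormedModule.NormedModule R_AbsRing ?X => vcanon X end]
  end.

(** * Norms, and limits in terms of epsilon and delta *)

Section Norms.
Context {X : CompleteNormedModule R_AbsRing}.

Lemma norm_scal_R (a : R) (v : X) : norm (scal a v) = Rabs a * norm v.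
Proof.
  apply Rle_antisym; [apply (norm_scal a v)|].
  destruct (Req_dec a 0) as [->|Ha].
  - rewrite Rabs_R0, Rmult_0_l; apply norm_ge_0.
  (* The norm axiom gives one inequality; applied to the scalar [/ a] it gives the converse. *)
  - replace v with (scal (/ a) (scal a v)) at 1 by vfield.
    apply Rle_trans with (Rabs a * (Rabs (/ a) * norm (scal a v))).
    + apply Rmult_le_compat_l; [apply Rabs_pos|]. exact (norm_scal (/ a) (scal a v)).
    + rewrite <- Rmult_assoc, <- Rabs_mult, Rinv_r, Rabs_R1, Rmult_1_l by trivial. apply Rle_refl.
Qed.

Lemma norm_plus (u v : X) : norm (plus u v) <= norm u + norm v.
Proof. exact (norm_triangle u v). Qed.

Lemma norm_opp_eq (u : X) : norm (opp u) = norm u.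
Proof. exact (norm_opp u). Qed.

Lemma norm0 : norm (zero : X) = 0.
Proof. exact (norm_zero (V := X)). Qed.

Lemma minus_self (u : X) : minus u u = (zero : X).
Proof. vring. Qed.

Lemma norm_minus_sym (u v : X) : norm (minus u v) = norm (minus v u).
Proof. rewrite <- norm_opp_eq. f_equal. vring. Qed.

Lemma norm_plus_le (u v : X) a b : norm u <= a -> norm v <= b -> norm (plus u v) <= a + b.
Proof. intros; eapply Rle_trans; [apply norm_plus|lra]. Qed.

Lemma norm_minus_le (u v : X) a b : norm u <= a -> norm v <= b -> norm (minus u v) <= a + b.
Proof. intros; apply norm_plus_le; trivial. fold (opp v); rewrite norm_opp_eq; trivial. Qed.

Lemma norm_minus_trans (u v w : X) : norm (minus u w) <= norm (minus u v) + norm (minus v w).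
Proof. replace (minus u w) with (plus (minus u v) (minus v w)) by vring. apply norm_plus. Qed.

(** Balls of the uniform structure and balls of the norm agree only up to a constant factor; this
    passes to norm balls once and for all. *)
Lemma locally_norm_iff (v : X) (P : X -> Prop) :
  locally v P <-> exists e, 0 < e /\ forall w, norm (minus w v) < e -> P w.
Proof.
  split.
  - intros H. apply (locally_norm_le_locally v P) in H. destruct H as [e He].
    exists e; split; [apply cond_pos|]. exact He.
  - intros (e & He & H). apply (locally_le_locally_norm v P). exists (mkposreal e He). exact H.
Qed.


Lemma filterlim_at_right_0_iff (f : R -> X) (v : X) :
  filterlim f (at_right 0) (locally v) <->
  forall e, 0 < e -> exists d, 0 < d /\ forall t, 0 < t < d -> norm (minus (f t) v) < e.
Proof.
  split.
  - intros H e He.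
    destruct (H (fun w => norm (minus w v) < e)) as [d Hd].
    { apply locally_norm_iff. exists e; split; trivial. }
    exists d; split; [apply cond_pos|]. intros t Ht. apply (Hd t); [|lra].
    change (Rabs (t - 0) < d). rewrite Rminus_0_r, Rabs_pos_eq; lra.
  - intros H P HP. apply locally_norm_iff in HP. destruct HP as (e & He & HP).
    destruct (H e He) as (d & Hd & Ht). exists (mkposreal d Hd). intros t Hb H0.
    apply HP, Ht. split; trivial.
    change (Rabs (t - 0) < d) in Hb. rewrite Rminus_0_r, Rabs_pos_eq in Hb; lra.
Qed.

Lemma continuous_iff_norm (f : R -> X) (x : R) :
  continuous f x <->
  forall e, 0 < e -> exists d, 0 < d /\ forall y, Rabs (y - x) < d -> norm (minus (f y) (f x)) < e.
Proof.
  split.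
  - intros H e He.
    destruct (H (fun w => norm (minus w (f x)) < e)) as [d Hd].
    { apply locally_norm_iff. exists e; split; trivial. }
    exists d; split; [apply cond_pos|]. exact Hd.
  - intros H P HP. apply locally_norm_iff in HP. destruct HP as (e & He & HP).
    destruct (H e He) as (d & Hd & Ht). exists (mkposreal d Hd). intros t Hb.
    apply HP, Ht, Hb.
Qed.

(** Multiplied out, the difference quotient becomes a first-order expansion in which y = x is
    harmless and which passes easily through sums and scalings. *)
Lemma deriv_on_nonneg_iff (f : R -> X) (x : R) (d : X) : 0 <= x ->
  deriv_on_nonneg f x d <->
  forall e, 0 < e -> exists dl, 0 < dl /\ forall y, 0 <= y -> Rabs (y - x) < dl ->
    norm (minus (minus (f y) (f x)) (scal (y - x) d)) <= e * Rabs (y - x).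
Proof.
  intros Hx; split.
  - intros H e He.
    destruct (H (fun w => norm (minus w d) < e)) as [dl Hd].
    { apply locally_norm_iff. exists e; split; trivial. }
    exists dl; split; [apply cond_pos|]. intros y Hy Hyx.
    destruct (Req_dec y x) as [->|Hne].
    { rewrite Rminus_diag, Rabs_R0, Rmult_0_r. right.
      etransitivity; [|apply norm0]. f_equal. vring. }
    assert (Hn : y - x <> 0) by lra.
    replace (minus (minus (f y) (f x)) (scal (y - x) d)) with
      (scal (y - x) (minus (scal (/ (y - x)) (minus (f y) (f x))) d)) by vfield.
    rewrite norm_scal_R, Rmult_comm. apply Rmult_le_compat_r; [apply Rabs_pos|].
    left. apply (Hd y); auto.
  - intros H P HP. apply locally_norm_iff in HP. destruct HP as (e & He & HP).
    destruct (H (e / 2)) as (dl & Hdl & Ht); [lra|].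
    exists (mkposreal dl Hdl). intros y Hb [Hy Hne]. apply HP.
    assert (Hn : y - x <> 0) by lra.
    change (norm (minus (scal (/ (y - x)) (minus (f y) (f x))) d) < e).
    replace (minus (scal (/ (y - x)) (minus (f y) (f x))) d) with
      (scal (/ (y - x)) (minus (minus (f y) (f x)) (scal (y - x) d))) by vfield.
    rewrite norm_scal_R. specialize (Ht y Hy Hb).
    assert (Hp := Rabs_pos_lt _ Hn). rewrite Rabs_inv.
    apply (Rmult_lt_reg_l (Rabs (y - x))); trivial.
    rewrite <- Rmult_assoc, Rinv_r, Rmult_1_l by lra. nra.
Qed.

End Norms.

Lemma cauchy_seq_converges {X : CompleteNormedModule R_AbsRing} (u : nat -> X) :
  (forall e, 0 < e -> exists N, forall n m, (N <= n)%nat -> (N <= m)%nat ->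
    norm (minus (u n) (u m)) < e) ->
  exists l, forall e, 0 < e -> exists N, forall n, (N <= n)%nat -> norm (minus (u n) l) < e.
Proof.
  intros H.
  destruct (proj1 (filterlim_locally_cauchy (F := eventually) u)) as [l Hl].
  - intros e.
    destruct (H e (cond_pos e)) as [N HN].
    exists (fun n => (N <= n)%nat); split; [exists N; auto|].
    intros n m Hn Hm.
    apply (norm_compat1 (V := X)). apply HN; trivial.
  - exists l. intros e He.
    destruct (Hl (fun w => norm (minus w l) < e)) as [N HN].
    { apply locally_norm_iff. exists e; split; trivial. }
    exists N. exact HN.
Qed.

(** * Strongly continuous semigroups *)

Section Semigroup.
Context {X : CompleteNormedModule R_AbsRing} (E : R -> X -> X).
Hypothesis HE : C0_semigroup E.

Lemma sg_plus t u v : 0 <= t -> E t (plus u v) = plus (E t u) (E t v).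
Proof. destruct HE as (H & _). auto. Qed.
Lemma sg_scal t a v : 0 <= t -> E t (scal a v) = scal a (E t v).
Proof. destruct HE as (_ & H & _). auto. Qed.
Lemma sg_0 v : E 0 v = v.
Proof. destruct HE as (_ & _ & _ & H & _). auto. Qed.
Lemma sg_add t s v : 0 <= t -> 0 <= s -> E (t + s) v = E t (E s v).
Proof. destruct HE as (_ & _ & _ & _ & H & _). auto. Qed.
Lemma sg_minus t u v : 0 <= t -> E t (minus u v) = minus (E t u) (E t v).
Proof.
  intros Ht. replace (minus u v) with (plus u (scal (-1) v)) by vring.
  rewrite sg_plus, sg_scal by trivial. vring.
Qed.
Lemma sg_zero t : 0 <= t -> E t zero = zero.
Proof.
  intros Ht. replace (zero : X) with (scal 0 (zero : X)) at 1 by vring.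
  rewrite sg_scal by trivial. vring.
Qed.
Lemma sg_cont_0 v e : 0 < e ->
  exists d, 0 < d /\ forall t, 0 <= t < d -> norm (minus (E t v) v) < e.
Proof.
  intros He. destruct HE as (_ & _ & _ & _ & _ & H).
  destruct (proj1 (filterlim_at_right_0_iff _ _) (H v) e He) as (d & Hd & Hc).
  exists d; split; trivial. intros t Ht.
  destruct (Req_dec t 0) as [->|Hn]; [|apply Hc; lra].
  rewrite sg_0. rewrite minus_self, norm0; lra.
Qed.

(* Osgood's argument: otherwise every closed ball contains a smaller one on which some [E t v],
   with [t <= 1/(n+1)], exceeds [n]; the common point of nested balls of this kind contradicts
   strong continuity at 0. *)
Lemma sg_bounded_near_0 :
  exists d M, 0 < d /\ 0 <= M /\ forall t v, 0 <= t <= d -> norm (E t v) <= M * norm v.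
Proof.
  destruct (classic (exists (n : nat) (x : X) (r : R), 0 < r /\
    forall t (y : X), 0 <= t <= / INR (S n) -> norm (minus y x) <= r -> norm (E t y) <= INR n))
    as [(n & x & r & Hr & H)|H].
  - exists (/ INR (S n)), (2 * INR n / r).
    split; [apply Rinv_0_lt_compat, lt_0_INR; lia|].
    split. { apply Rdiv_le_0_compat; trivial. pose proof (pos_INR n); lra. }
    intros t v Ht.
    destruct (Req_dec (norm v) 0) as [Hv|Hv].
    { assert (v = zero) as -> by exact (norm_eq_zero _ Hv).
      rewrite sg_zero, norm0 by lra. lra. }
    assert (Hv0 : 0 < norm v) by (pose proof (norm_ge_0 v); lra).
    (* Scaling [v] to length [r] puts [x + k v] in the ball where the bound holds, so [k E t v] is a
       difference of two bounded values. *)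
    set (k := r / norm v). assert (Hk : 0 < k) by (apply Rdiv_lt_0_compat; trivial).
    assert (Hk0 : k <> 0) by lra.
    replace (E t v) with (scal (/ k) (minus (E t (plus x (scal k v))) (E t x)))
      by (rewrite sg_plus, sg_scal by lra; vfield).
    rewrite norm_scal_R, Rabs_pos_eq by (left; apply Rinv_0_lt_compat, Hk).
    replace (2 * INR n / r * norm v) with (/ k * (INR n + INR n)) by (unfold k; field; lra).
    apply Rmult_le_compat_l; [left; apply Rinv_0_lt_compat, Hk|].
    apply norm_minus_le; apply H; trivial.
    + replace (minus (plus x (scal k v)) x) with (scal k v) by vring.
      rewrite norm_scal_R, Rabs_pos_eq by lra. unfold k. right; field; trivial.
    + rewrite minus_self, norm0; lra.
  - exfalso.
    (* [choice] wants a witness for every argument, so positivity of the radius is a premise under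
       the existential. *)
    assert (Hstep : forall (p : nat * (X * R)), exists q : X * R, 0 < snd (snd p) ->
      0 < snd q <= snd (snd p) / 2 /\ norm (minus (fst q) (fst (snd p))) <= snd (snd p) / 2 /\
      exists t, 0 <= t <= / INR (S (fst p)) /\
        forall y : X, norm (minus y (fst q)) <= snd q -> INR (fst p) < norm (E t y)).
    { intros (n & x & r); simpl fst; simpl snd.
      destruct (Rlt_dec 0 r) as [Hr|Hr]; [|exists (x, r); intros; contradiction].
      apply NNPP; intros Hnot. apply H. exists n, x, (r / 2). split; [lra|].
      intros t y Ht Hy. apply Rnot_lt_le; intros Hlt. apply Hnot.
      destruct HE as (_ & _ & HB & _). destruct (HB t) as [M HM]; [lra|].
      (* Within [rho] of [y], the value of [E t] moves by at most half the excess of [norm (E t y)]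
         over [n]. *)
      set (rho := Rmin (r / 2) ((norm (E t y) - INR n) / (2 * (Rabs M + 1)))).
      assert (HM0 : 0 < Rabs M + 1) by (pose proof (Rabs_pos M); lra).
      assert (Hrho : 0 < rho).
      { apply Rmin_glb_lt; [lra|]. apply Rdiv_lt_0_compat; lra. }
      exists (y, rho). intros _. split; [split; [exact Hrho|apply Rmin_l]|]. split; [exact Hy|].
      exists t. split; trivial. simpl. intros z Hz.
      assert (H1 : norm (E t y) <= norm (E t z) + norm (E t (minus y z))).
      { rewrite sg_minus by lra.
        replace (E t y) with (plus (E t z) (minus (E t y) (E t z))) at 1 by vring. apply norm_plus. }
      assert (H2 : norm (E t (minus y z)) <= (Rabs M + 1) * rho).
      { apply Rle_trans with (1 := HM _). rewrite norm_minus_sym in Hz.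
        pose proof (Rle_abs M). pose proof (norm_ge_0 (minus y z)).
        apply Rle_trans with ((Rabs M + 1) * norm (minus y z)); nra. }
      assert (H3 : (Rabs M + 1) * rho <= (norm (E t y) - INR n) / 2).
      { apply Rle_trans with ((Rabs M + 1) * ((norm (E t y) - INR n) / (2 * (Rabs M + 1)))).
        - apply Rmult_le_compat_l; [lra|apply Rmin_r].
        - right; field; lra. }
      lra. }
    destruct (constructive_indefinite_description _ (choice _ Hstep)) as [f Hf].
    pose (s := fix s (n : nat) : X * R :=
      match n with O => (zero, 1) | S m => f (m, s m) end).
    assert (Hpos : forall n, 0 < snd (s n)).
    { induction n as [|n IH]; simpl; [lra|]. apply (Hf (n, s n) IH). }
    assert (Hr : forall n, snd (s (S n)) <= snd (s n) / 2) by (intros n; apply (Hf (n, s n) (Hpos n))).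
    assert (Hx : forall n, norm (minus (fst (s (S n))) (fst (s n))) <= snd (s n) / 2)
      by (intros n; apply (Hf (n, s n) (Hpos n))).
    assert (Hnest : forall n k, norm (minus (fst (s (n + k)%nat)) (fst (s n))) <= snd (s n) - snd (s (n + k)%nat)).
    { intros n; induction k as [|k IH].
      - rewrite Nat.add_0_r. rewrite minus_self, norm0; lra.
      - rewrite Nat.add_succ_r.
        eapply Rle_trans; [apply (norm_minus_trans _ (fst (s (n + k)%nat)))|].
        specialize (Hx (n + k)%nat); specialize (Hr (n + k)%nat). lra. }
    assert (Hgeo : forall n, snd (s n) <= / 2 ^ n).
    { induction n as [|n IH]; [simpl; lra|]. specialize (Hr n).
      assert (H2 : / 2 ^ S n = / 2 ^ n / 2)
        by (change (2 ^ S n) with (2 * 2 ^ n); field; apply pow_nonzero; lra). lra. }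
    assert (Hsmall : forall e, 0 < e -> exists n, / 2 ^ n < e).
    { intros e He. destruct (pow_lt_1_zero (/ 2)) with (y := e) as [n Hn]; trivial.
      { rewrite Rabs_pos_eq; lra. }
      exists n. specialize (Hn n (le_n n)). rewrite <- pow_inv.
      apply Rle_lt_trans with (2 := Hn). apply Rle_abs. }
    destruct (cauchy_seq_converges (fun n => fst (s n))) as [v Hv].
    { intros e He. destruct (Hsmall (e / 2)) as [N HN]; [lra|]. exists N.
      intros n m Hn Hm.
      apply Rle_lt_trans with (1 := norm_minus_trans _ (fst (s N)) _).
      rewrite (norm_minus_sym (fst (s N))).
      replace n with (N + (n - N))%nat by lia. replace m with (N + (m - N))%nat by lia.
      pose proof (Hnest N (n - N)%nat). pose proof (Hnest N (m - N)%nat).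
      pose proof (Hpos (N + (n - N))%nat). pose proof (Hpos (N + (m - N))%nat).
      specialize (Hgeo N). lra. }
    assert (Hin : forall n, norm (minus v (fst (s n))) <= snd (s n)).
    { intros n. apply le_epsilon. intros e He. destruct (Hv e He) as [N HN].
      specialize (HN (n + N)%nat ltac:(lia)). specialize (Hnest n N).
      pose proof (Hpos (n + N)%nat). rewrite norm_minus_sym in HN.
      apply Rle_trans with (1 := norm_minus_trans _ (fst (s (n + N)%nat)) _). lra. }
    destruct (sg_cont_0 v 1) as (d & Hd & Hc); [lra|].
    (* This [n] gives both [n + 1 > norm v + 1] and [/ (n + 2) < d], so the ball chosen at stage
       [n + 1], which contains [v], contradicts [Hc]. *)
    destruct (nfloor_ex (norm v + 1 + / d)) as [n [Hn1 Hn2]].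
    { pose proof (norm_ge_0 v). pose proof (Rinv_0_lt_compat d Hd). lra. }
    destruct (Hf (S n, s (S n)) (Hpos (S n))) as (_ & _ & t & Ht & Hb).
    specialize (Hb v (Hin (S (S n)))). simpl fst in *.
    rewrite !S_INR in *.
    assert (Hdn : / (INR n + 1 + 1) < d).
    { rewrite <- (Rinv_inv d). pose proof (norm_ge_0 v). pose proof (Rinv_0_lt_compat d Hd).
      apply Rinv_lt_contravar; [apply Rmult_lt_0_compat|]; lra. }
    specialize (Hc t ltac:(lra)).
    assert (norm (E t v) <= norm (minus (E t v) v) + norm v).
    { replace (E t v) with (plus (minus (E t v) v) v) at 1 by vring. apply norm_plus. }
    pose proof (Rinv_0_lt_compat d Hd). lra.
Qed.

(** The semigroup law spreads the bound near 0: each further interval of length [d] multiplies the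
    constant by [M + 1], which is at least 1, so that earlier bounds stay valid. *)
Lemma sg_bounded T :
  exists M, 1 <= M /\ forall t v, 0 <= t <= T -> norm (E t v) <= M * norm v.
Proof.
  destruct sg_bounded_near_0 as (d & M & Hd & HM & Hb).
  assert (Hk : forall k : nat, exists K, 1 <= K /\
    forall t v, 0 <= t <= INR k * d -> norm (E t v) <= K * norm v).
  { induction k as [|k (K & HK & Hk)].
    - exists 1; split; [lra|]. intros t v Ht. simpl in Ht. replace t with 0 by lra.
      rewrite sg_0; lra.
    - exists (K * (M + 1)); split; [nra|]. intros t v Ht. rewrite S_INR in Ht.
      destruct (Rle_dec t (INR k * d)) as [H|H].
      + apply Rle_trans with (1 := Hk t v ltac:(lra)). pose proof (norm_ge_0 v).
        apply Rmult_le_compat_r; nra.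
      + pose proof (pos_INR k).
        assert (Hkd : 0 <= INR k * d) by nra.
        replace t with (INR k * d + (t - INR k * d)) by ring.
        rewrite sg_add by lra.
        apply Rle_trans with (1 := Hk (INR k * d) (E (t - INR k * d) v) (conj Hkd (Rle_refl _))).
        rewrite Rmult_assoc. apply Rmult_le_compat_l; [lra|].
        apply Rle_trans with (1 := Hb (t - INR k * d) v ltac:(lra)). pose proof (norm_ge_0 v). nra. }
  destruct (nfloor_ex (Rabs T / d)) as [n [Hn1 Hn2]].
  { apply Rdiv_le_0_compat; trivial; apply Rabs_pos. }
  destruct (Hk (S n)) as (K & HK & HKb). exists K; split; trivial.
  intros t v Ht. apply HKb. rewrite S_INR. split; [lra|].
  apply Rle_trans with (1 := proj2 Ht). apply Rle_trans with (1 := Rle_abs T).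
  replace (Rabs T) with (Rabs T / d * d) by (field; lra).
  apply Rmult_le_compat_r; lra.
Qed.

Section Bound.
Context (T M : R).
Hypothesis HM : 0 <= M.
Hypothesis Hbound : forall t v, 0 <= t <= T -> norm (E t v) <= M * norm v.

Lemma sg_increment t s v : 0 <= t -> 0 <= s -> t + s <= T ->
  norm (minus (E (t + s) v) (E t v)) <= M * norm (minus (E s v) v).
Proof.
  intros Ht Hs Hts. rewrite sg_add, <- sg_minus by trivial. apply Hbound; lra.
Qed.

(* Telescoping over [k] steps of length [t/k] replaces the integral formula
   [E t v - v = int_0^t E s (A v) ds]. *)
Lemma sg_generator_bound DA A t v : generator E DA A -> DA v -> 0 <= t <= T ->
  norm (minus (E t v) v) <= M * (t * norm (A v)).
Proof.
  intros [_ HA] Hv Ht.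
  destruct (Req_dec t 0) as [->|Hn].
  { rewrite sg_0. rewrite minus_self, norm0; lra. }
  apply le_epsilon. intros e0 He0.
  (* Over all the steps the errors of the difference quotient add up to [M * t * e], which this
     choice keeps at most [e0]. *)
  set (e := e0 / (M * t + 1)).
  assert (HMt : 0 < M * t + 1) by nra.
  assert (He : 0 < e) by (apply Rdiv_lt_0_compat; trivial).
  destruct (proj1 (filterlim_at_right_0_iff _ _) (HA v Hv) e He) as (d & Hd & Hc).
  destruct (nfloor_ex (t / d)) as [k [Hk1 Hk2]]; [apply Rdiv_le_0_compat; lra|].
  set (s := t / INR (S k)).
  assert (HS : 0 < INR (S k)) by (apply lt_0_INR; lia).
  assert (Hs : 0 < s < d).
  { split; [apply Rdiv_lt_0_compat; lra|]. unfold s. rewrite S_INR in *.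
    apply (Rmult_lt_reg_r (INR k + 1)); trivial.
    replace (t / (INR k + 1) * (INR k + 1)) with (t / d * d) by (field; lra).
    nra. }
  assert (Hone : norm (minus (E s v) v) <= s * (norm (A v) + e)).
  { replace (minus (E s v) v) with (scal s (scal (/ s) (minus (E s v) v))) by (vnorm; field; lra).
    rewrite norm_scal_R, Rabs_pos_eq by lra. apply Rmult_le_compat_l; [lra|].
    specialize (Hc s Hs).
    replace (scal (/ s) (minus (E s v) v)) with
      (plus (A v) (minus (scal (/ s) (minus (E s v) v)) (A v))) by vring.
    apply norm_plus_le; [apply Rle_refl|left; exact Hc]. }
  assert (Hsum : forall j : nat, (j <= S k)%nat ->
    norm (minus (E (INR j * s) v) v) <= INR j * (M * (s * (norm (A v) + e)))).
  { induction j as [|j IH]; intros Hj.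
    - simpl. rewrite Rmult_0_l, sg_0, Rmult_0_l.
      rewrite minus_self, norm0; lra.
    - apply Rle_trans with (1 := norm_minus_trans _ (E (INR j * s) v) _).
      assert (HjT : INR (S j) * s <= T).
      { apply Rle_trans with (INR (S k) * s).
        - apply Rmult_le_compat_r; [lra|]. apply le_INR; trivial.
        - unfold s. replace (INR (S k) * (t / INR (S k))) with t by (field; lra). lra. }
      rewrite S_INR in *. specialize (IH ltac:(lia)).
      assert (Hi := sg_increment (INR j * s) s v).
      replace (INR j * s + s) with ((INR j + 1) * s) in Hi by ring.
      pose proof (pos_INR j).
      specialize (Hi ltac:(nra) ltac:(lra) HjT).
      assert (M * norm (minus (E s v) v) <= M * (s * (norm (A v) + e)))
        by (apply Rmult_le_compat_l; trivial).
      lra. }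
  specialize (Hsum (S k) (le_n _)).
  replace (INR (S k) * s) with t in Hsum by (unfold s; field; lra).
  replace (INR (S k) * (M * (s * (norm (A v) + e)))) with (M * (t * norm (A v)) + M * t * e)
    in Hsum by (unfold s; field; lra).
  assert (M * t * e <= e0).
  { unfold e. replace e0 with ((M * t + 1) * (e0 / (M * t + 1))) at 2 by (field; lra).
    apply Rmult_le_compat_r; [left; exact He|lra]. }
  lra.
Qed.
End Bound.

(* [E] is only meaningful on [0, oo); extending it by [E 0] makes it strongly continuous on the
   whole line, so that integrands are continuous up to and beyond the ends of the interval. *)
Lemma sg_continuous_extension (g : R -> X) (a : R) :
  (forall s, continuous g s) ->
  forall s, continuous (fun s => E (Rmax 0 (a - s)) (g s)) s.
Proof.
  intros Hg s.
  set (p := fun s => Rmax 0 (a - s)).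
  assert (Hp : forall y, Rabs (p y - p s) <= Rabs (y - s)).
  { intros y. unfold p, Rmax. destruct (Rle_dec 0 (a - y)), (Rle_dec 0 (a - s));
    unfold Rabs; repeat destruct Rcase_abs; lra. }
  assert (Hp0 : forall y, 0 <= p y) by (intros; apply Rmax_l).
  destruct (sg_bounded (p s + 1)) as (M & HM & HB).
  apply continuous_iff_norm. intros e He.
  destruct (sg_cont_0 (g s) (e / (2 * M))) as (d1 & Hd1 & Hc); [apply Rdiv_lt_0_compat; lra|].
  destruct (proj1 (continuous_iff_norm g s) (Hg s) (e / (2 * M))) as (d2 & Hd2 & Hc2).
  { apply Rdiv_lt_0_compat; lra. }
  exists (Rmin 1 (Rmin d1 d2)). split; [repeat apply Rmin_glb_lt; lra|].
  intros y Hy.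
  assert (Hy1 : Rabs (y - s) < 1) by (apply Rlt_le_trans with (1 := Hy); apply Rmin_l).
  assert (Hy2 : Rabs (y - s) < d1).
  { apply Rlt_le_trans with (1 := Hy). apply Rle_trans with (1 := Rmin_r _ _), Rmin_l. }
  assert (Hy3 : Rabs (y - s) < d2).
  { apply Rlt_le_trans with (1 := Hy). apply Rle_trans with (1 := Rmin_r _ _), Rmin_r. }
  change (norm (minus (E (p y) (g y)) (E (p s) (g s))) < e).
  specialize (Hp y).
  assert (Hys : p y <= p s + 1) by (pose proof (Rle_abs (p y - p s)); lra).
  apply Rle_lt_trans with (1 := norm_minus_trans _ (E (p y) (g s)) _).
  rewrite <- sg_minus by apply Hp0.
  pose proof (HB (p y) (minus (g y) (g s)) (conj (Hp0 y) Hys)) as H1.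
  specialize (Hc2 y Hy3).
  assert (Hlt : M * norm (minus (g y) (g s)) < e / 2).
  { replace (e / 2) with (M * (e / (2 * M))) by (field; lra). apply Rmult_lt_compat_l; lra. }
  assert (Hq : forall q, 0 <= q < d1 -> M * norm (minus (E q (g s)) (g s)) < e / 2).
  { intros q Hq. replace (e / 2) with (M * (e / (2 * M))) by (field; lra).
    apply Rmult_lt_compat_l; [lra|]. apply Hc, Hq. }
  enough (norm (minus (E (p y) (g s)) (E (p s) (g s))) < e / 2) by lra.
  (* The smaller of the two times factors out, leaving continuity at 0 of the orbit of the fixed
     vector [g s]. *)
  destruct (Rle_dec (p s) (p y)) as [Hle|Hle].
  - rewrite Rabs_pos_eq in Hp by lra.
    apply Rle_lt_trans with (M * norm (minus (E (p y - p s) (g s)) (g s))); [|apply Hq; lra].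
    replace (p y) with (p s + (p y - p s)) at 1 by ring.
    apply (sg_increment (p s + 1) M); solve [apply Hp0 | exact HB | lra].
  - rewrite Rabs_left in Hp by lra.
    apply Rle_lt_trans with (M * norm (minus (E (p s - p y) (g s)) (g s))); [|apply Hq; lra].
    rewrite norm_minus_sym.
    replace (p s) with (p y + (p s - p y)) at 1 by ring.
    apply (sg_increment (p s + 1) M); solve [apply Hp0 | exact HB | lra].
Qed.

(** A bounded linear map commutes with every Riemann sum, and boundedness carries this to the
    limit. *)
Lemma sg_RInt t (f : R -> X) a b : 0 <= t -> ex_RInt f a b ->
  E t (RInt f a b) = RInt (fun s => E t (f s)) a b.
Proof.
  intros Ht Hf. symmetry. apply is_RInt_unique.
  apply RInt_correct in Hf. unfold is_RInt in *.
  destruct HE as (_ & _ & HB & _). destruct (HB t Ht) as [M HM].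
  assert (HS : forall ptd, scal (sign (b - a)) (Riemann_sum (fun s => E t (f s)) ptd) =
    E t (scal (sign (b - a)) (Riemann_sum f ptd))).
  { intros ptd. rewrite sg_scal by trivial. f_equal.
    pattern ptd; apply SF_cons_ind.
    - intros x0. unfold Riemann_sum; simpl. symmetry; apply sg_zero, Ht.
    - intros x0 s IH. rewrite !Riemann_sum_cons.
      etransitivity; [|symmetry; apply sg_plus, Ht]. rewrite IH. f_equal.
      symmetry; apply sg_scal, Ht. }
  intros P HP. apply locally_norm_iff in HP. destruct HP as (e & He & HP).
  assert (HQ : locally (RInt f a b) (fun w => norm (minus w (RInt f a b)) < e / (Rabs M + 1))).
  { apply locally_norm_iff. exists (e / (Rabs M + 1)). split; trivial.
    apply Rdiv_lt_0_compat; trivial. pose proof (Rabs_pos M); lra. }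
  apply Hf in HQ. unfold filtermap in *.
  eapply filter_imp; [|exact HQ]. intros ptd Hptd. rewrite HS. apply HP.
  rewrite <- sg_minus by trivial. apply Rle_lt_trans with (1 := HM _).
  set (w := minus _ _) in *. change (norm w < e / (Rabs M + 1)) in Hptd.
  pose proof (Rabs_pos M). pose proof (Rle_abs M). pose proof (norm_ge_0 w).
  apply Rle_lt_trans with ((Rabs M + 1) * norm w); [nra|].
  replace e with ((Rabs M + 1) * (e / (Rabs M + 1))) by (field; lra).
  apply Rmult_lt_compat_l; lra.
Qed.

End Semigroup.

(** * Vector-valued calculus *)

Section Calculus.
Context {X : CompleteNormedModule R_AbsRing}.

(** Since [f'] need not be integrable and X has no exact mean value theorem, the proof is a
    continuity induction: the supremum of the points reached with slope [K + e] is shown to be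
    [b]. *)
Lemma mean_value_inequality (f f' : R -> X) (a b K : R) : 0 <= a <= b ->
  (forall x, a <= x <= b -> deriv_on_nonneg f x (f' x) /\ norm (f' x) <= K) ->
  norm (minus (f b) (f a)) <= K * (b - a).
Proof.
  intros Hab Hf. apply le_epsilon. intros e0 He0.
  set (e := e0 / (b - a + 1)).
  assert (He : 0 < e) by (apply Rdiv_lt_0_compat; lra).
  assert (Hee : e * (b - a) <= e0).
  { unfold e. replace e0 with (e0 / (b - a + 1) * (b - a + 1)) at 2 by (field; lra).
    apply Rmult_le_compat_l; [left; exact He|lra]. }
  assert (Hloc : forall x, a <= x <= b -> exists d, 0 < d /\
    forall y, 0 <= y -> Rabs (y - x) < d -> norm (minus (f y) (f x)) <= (K + e) * Rabs (y - x)).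
  { intros x Hx. destruct (Hf x Hx) as [Hd HK].
    destruct (proj1 (deriv_on_nonneg_iff f x (f' x) ltac:(lra)) Hd e He) as (d & Hd0 & Hdy).
    exists d; split; trivial. intros y Hy Hyx. specialize (Hdy y Hy Hyx).
    replace (minus (f y) (f x)) with
      (plus (minus (minus (f y) (f x)) (scal (y - x) (f' x))) (scal (y - x) (f' x))) by vring.
    replace ((K + e) * Rabs (y - x)) with (e * Rabs (y - x) + Rabs (y - x) * K) by ring.
    apply norm_plus_le; trivial. rewrite norm_scal_R.
    apply Rmult_le_compat_l; [apply Rabs_pos|trivial]. }
  set (S := fun x => a <= x <= b /\ norm (minus (f x) (f a)) <= (K + e) * (x - a)).
  assert (Sa : S a).
  { split; [lra|]. rewrite minus_self, norm0; lra. }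
  destruct (completeness S) as [c [Hub Hlub]].
  { exists b. intros x [Hx _]; lra. }
  { exists a; exact Sa. }
  assert (Hac : a <= c) by (apply Hub, Sa).
  assert (Hcb : c <= b) by (apply Hlub; intros x [Hx _]; lra).
  destruct (Hloc c) as (d & Hd & Hdc); [lra|].
  (* The supremum belongs to [S]: some point of [S] lies within [d] of it, and the local estimate at
     [c] bridges the gap. *)
  assert (Sc : S c).
  { destruct (classic (exists x, S x /\ c - d < x)) as [(x & Hx & Hxc)|Hno].
    - assert (Hle : x <= c) by (apply Hub, Hx). destruct Hx as [Hx Hb].
      split; [lra|].
      apply Rle_trans with (1 := norm_minus_trans _ (f x) _).
      rewrite (norm_minus_sym (f c)).
      assert (H := Hdc x ltac:(lra)). rewrite Rabs_left1 in H by lra.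
      specialize (H ltac:(lra)). lra.
    - exfalso. assert (c <= c - d); [|lra]. apply Hlub. intros x Hx.
      apply Rnot_lt_le. intros Hlt. apply Hno. exists x; split; trivial. }
  destruct Sc as [_ Hc].
  destruct (Rle_lt_or_eq_dec c b Hcb) as [Hlt| ->]; [|lra].
  exfalso.
  set (y := c + Rmin (d / 2) (b - c)).
  assert (Hy : c < y <= b /\ y <= c + d / 2).
  { unfold y, Rmin. destruct Rle_dec; lra. }
  assert (Sy : S y).
  { split; [lra|]. apply Rle_trans with (1 := norm_minus_trans _ (f c) _).
    assert (H := Hdc y ltac:(lra)). rewrite Rabs_pos_eq in H by lra.
    specialize (H ltac:(lra)). lra. }
  assert (y <= c) by (apply Hub, Sy). lra.
Qed.

Lemma mean_value_inequality_abs (f f' : R -> X) (a b K x y : R) : 0 <= a ->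
  (forall z, a <= z <= b -> deriv_on_nonneg f z (f' z) /\ norm (f' z) <= K) ->
  a <= x <= b -> a <= y <= b -> norm (minus (f y) (f x)) <= K * Rabs (y - x).
Proof.
  intros Ha Hf Hx Hy. destruct (Rle_dec x y) as [H|H].
  - rewrite Rabs_pos_eq by lra. apply mean_value_inequality with f'; [lra|].
    intros z Hz; apply Hf; lra.
  - rewrite Rabs_left, norm_minus_sym by lra. replace (- (y - x)) with (x - y) by ring.
    apply mean_value_inequality with f'; [lra|]. intros z Hz; apply Hf; lra.
Qed.

Lemma deriv_minus (f g : R -> X) x df dg : 0 <= x ->
  deriv_on_nonneg f x df -> deriv_on_nonneg g x dg ->
  deriv_on_nonneg (fun y => minus (f y) (g y)) x (minus df dg).
Proof.
  intros Hx Hf Hg. apply deriv_on_nonneg_iff; trivial. intros e He.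
  destruct (proj1 (deriv_on_nonneg_iff f x df Hx) Hf (e / 2)) as (d1 & Hd1 & H1); [lra|].
  destruct (proj1 (deriv_on_nonneg_iff g x dg Hx) Hg (e / 2)) as (d2 & Hd2 & H2); [lra|].
  exists (Rmin d1 d2); split; [apply Rmin_glb_lt; trivial|]. intros y Hy Hyx.
  replace (minus (minus (minus (f y) (g y)) (minus (f x) (g x))) (scal (y - x) (minus df dg)))
    with (minus (minus (minus (f y) (f x)) (scal (y - x) df))
      (minus (minus (g y) (g x)) (scal (y - x) dg))) by vring.
  replace (e * Rabs (y - x)) with (e / 2 * Rabs (y - x) + e / 2 * Rabs (y - x)) by field.
  apply norm_minus_le.
  - apply H1; trivial. apply Rlt_le_trans with (1 := Hyx), Rmin_l.
  - apply H2; trivial. apply Rlt_le_trans with (1 := Hyx), Rmin_r.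
Qed.

Lemma deriv_scal (g : R -> R) x dg (v : X) : 0 <= x ->
  is_derive g x dg -> deriv_on_nonneg (fun y => scal (g y) v) x (scal dg v).
Proof.
  intros Hx [_ Hg]. apply deriv_on_nonneg_iff; trivial. intros e He.
  assert (Hv : 0 < norm v + 1) by (pose proof (norm_ge_0 v); lra).
  destruct (Hg x (fun P H => H) (mkposreal (e / (norm v + 1)) (Rdiv_lt_0_compat _ _ He Hv)))
    as [d Hd].
  exists d; split; [apply cond_pos|]. intros y _ Hyx.
  specialize (Hd y Hyx).
  change (Rabs (g y - g x - (y - x) * dg) <= e / (norm v + 1) * Rabs (y - x)) in Hd.
  change (norm (minus (minus (scal (g y) v) (scal (g x) v)) (scal (y - x) (scal dg v)))
    <= e * Rabs (y - x)).
  replace (minus (minus (scal (g y) v) (scal (g x) v)) (scal (y - x) (scal dg v)))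
    with (scal (g y - g x - (y - x) * dg) v) by vring.
  rewrite norm_scal_R.
  apply Rle_trans with (e / (norm v + 1) * Rabs (y - x) * (norm v + 1)).
  - pose proof (norm_ge_0 v). apply Rmult_le_compat; try lra. apply Rabs_pos.
  - right; field; lra.
Qed.

Lemma deriv_vsum (g : nat -> R -> R) (dg : nat -> R) x (v : nat -> X) n : 0 <= x ->
  (forall j, (j < n)%nat -> is_derive (g j) x (dg j)) ->
  deriv_on_nonneg (fun y => vsum (fun j => scal (g j y) (v j)) n) x
    (vsum (fun j => scal (dg j) (v j)) n).
Proof.
  intros Hx Hg. apply deriv_on_nonneg_iff; trivial.
  induction n as [|n IH]; intros e He; simpl.
  - exists 1; split; [lra|]. intros y _ _.
    change (norm (minus (minus (zero : X) (zero : X)) (scal (y - x) (zero : X))) <= e * Rabs (y - x)).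
    replace (minus (minus (zero : X) (zero : X)) (scal (y - x) (zero : X))) with (zero : X) by vring.
    rewrite norm0. pose proof (Rabs_pos (y - x)). nra.
  - destruct (IH (fun j Hj => Hg j ltac:(lia)) (e / 2) ltac:(lra)) as (d1 & Hd1 & H1).
    destruct (proj1 (deriv_on_nonneg_iff _ x _ Hx) (deriv_scal _ x _ (v n) Hx (Hg n ltac:(lia)))
      (e / 2)) as (d2 & Hd2 & H2); [lra|].
    exists (Rmin d1 d2); split; [apply Rmin_glb_lt; trivial|]. intros y Hy Hyx.
    specialize (H1 y Hy (Rlt_le_trans _ _ _ Hyx (Rmin_l _ _))).
    specialize (H2 y Hy (Rlt_le_trans _ _ _ Hyx (Rmin_r _ _))).
    set (s1 := vsum _ n) in *. set (s2 := vsum (fun j => scal (g j x) (v j)) n) in *.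
    set (s3 := vsum (fun j => scal (dg j) (v j)) n) in *.
    replace (e * Rabs (y - x)) with (e / 2 * Rabs (y - x) + e / 2 * Rabs (y - x)) by field.
    eapply Rle_trans; [right|exact (norm_plus_le _ _ _ _ H1 H2)]. f_equal. vring.
Qed.

Lemma vsum_ext (f g : nat -> X) n :
  (forall j, (j < n)%nat -> f j = g j) -> vsum f n = vsum g n.
Proof.
  intros H; induction n as [|n IH]; simpl; trivial.
  rewrite IH, H by (intros; try apply H; lia). reflexivity.
Qed.

Lemma ex_RInt_vminus (f g : R -> X) a b : ex_RInt f a b -> ex_RInt g a b ->
  ex_RInt (fun x => minus (f x) (g x)) a b.
Proof. exact (ex_RInt_minus f g a b). Qed.

Lemma ex_RInt_vscal (f : R -> X) k a b : ex_RInt f a b -> ex_RInt (fun x => scal k (f x)) a b.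
Proof. exact (ex_RInt_scal f a b k). Qed.

Lemma RInt_vminus (f g : R -> X) a b : ex_RInt f a b -> ex_RInt g a b ->
  RInt (fun x => minus (f x) (g x)) a b = minus (RInt f a b) (RInt g a b).
Proof. exact (RInt_minus f g a b). Qed.

Lemma RInt_vplus (f g : R -> X) a b : ex_RInt f a b -> ex_RInt g a b ->
  RInt (fun x => plus (f x) (g x)) a b = plus (RInt f a b) (RInt g a b).
Proof. exact (RInt_plus f g a b). Qed.

Lemma RInt_vscal (f : R -> X) k a b : ex_RInt f a b ->
  RInt (fun x => scal k (f x)) a b = scal k (RInt f a b).
Proof. exact (RInt_scal f a b k). Qed.

Lemma norm_RInt_bound (f : R -> X) a b K : a <= b -> ex_RInt f a b ->
  (forall x, a <= x <= b -> norm (f x) <= K) -> norm (RInt f a b) <= (b - a) * K.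
Proof.
  intros Hab Hf HK.
  exact (norm_RInt_le_const f a b (RInt f a b) K Hab HK (RInt_correct f a b Hf)).
Qed.

(** Composition with this 1-Lipschitz retraction extends a function that is Lipschitz on [a, b] to a
    continuous one on the line, which is then integrable. *)
Definition clamp a b x := Rmax a (Rmin b x).

Lemma clamp_in a b x : a <= b -> a <= clamp a b x <= b.
Proof. intros; unfold clamp, Rmax, Rmin; repeat destruct Rle_dec; lra. Qed.

Lemma clamp_id a b x : a <= x <= b -> clamp a b x = x.
Proof. intros; unfold clamp, Rmax, Rmin; repeat destruct Rle_dec; lra. Qed.

Lemma clamp_lipschitz a b x y : a <= b -> Rabs (clamp a b y - clamp a b x) <= Rabs (y - x).
Proof.
  intros; unfold clamp, Rmax, Rmin; repeat destruct Rle_dec; unfold Rabs;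
  repeat destruct Rcase_abs; lra.
Qed.

Lemma lipschitz_continuous (f : R -> X) L :
  (forall x y, norm (minus (f y) (f x)) <= L * Rabs (y - x)) -> forall x, continuous f x.
Proof.
  intros HL x. apply continuous_iff_norm. intros e He.
  assert (HL1 : 0 < Rabs L + 1) by (pose proof (Rabs_pos L); lra).
  exists (e / (Rabs L + 1)). split; [apply Rdiv_lt_0_compat; trivial|].
  intros y Hy. apply Rle_lt_trans with (1 := HL x y).
  pose proof (Rle_abs L). pose proof (Rabs_pos (y - x)).
  apply Rle_lt_trans with ((Rabs L + 1) * Rabs (y - x)); [nra|].
  replace e with ((Rabs L + 1) * (e / (Rabs L + 1))) by (field; lra).
  apply Rmult_lt_compat_l; trivial.
Qed.

(* Unlike differentiability of the [F k], these inequalities pass to averages over segments by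
   integrating them, and ask nothing of the derivative of [F n]. *)
Definition quad_chain (a b : R) (n : nat) (L : R) (F : nat -> R -> X) : Prop :=
  forall x y, a <= x <= b -> a <= y <= b ->
    (forall k, (k < n)%nat ->
      norm (minus (minus (F k y) (F k x)) (scal (y - x) (F (S k) x))) <= L * (y - x) ^ 2) /\
    (forall k, (k <= n)%nat -> norm (minus (F k y) (F k x)) <= L * Rabs (y - x)).

Lemma segment_in a b x0 x t : a <= x0 <= b -> a <= x <= b -> 0 <= t <= 1 ->
  a <= x0 + t * (x - x0) <= b.
Proof. intros; nra. Qed.

Lemma ex_RInt_segment (f : R -> X) a b L x0 x k s t :
  (forall y z, a <= y <= b -> a <= z <= b -> norm (minus (f z) (f y)) <= L * Rabs (z - y)) ->
  0 <= L -> a <= x0 <= b -> a <= x <= b -> 0 <= s <= 1 -> 0 <= t <= 1 ->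
  ex_RInt (fun th => scal (th ^ k) (f (x0 + th * (x - x0)))) s t.
Proof.
  intros Hf HL Hx0 Hx Hs Ht.
  apply (ex_RInt_ext (fun th => scal (th ^ k) (f (clamp a b (x0 + th * (x - x0)))))).
  - intros th Hth. rewrite clamp_id; trivial. apply segment_in; trivial.
    revert Hth; unfold Rmin, Rmax; destruct Rle_dec; lra.
  - apply (ex_RInt_continuous (V := X)). intros z _.
    apply (continuous_scal (V := X)).
    + apply (ex_derive_continuous (K := R_AbsRing) (V := R_NormedModule)). auto_derive; trivial.
    + apply (continuous_comp (fun th => x0 + th * (x - x0)) (fun u => f (clamp a b u))).
      * apply (ex_derive_continuous (K := R_AbsRing) (V := R_NormedModule)). auto_derive; trivial.
      * apply lipschitz_continuous with L. intros u v.
        apply Rle_trans with (1 := Hf _ _ (clamp_in a b u ltac:(lra)) (clamp_in a b v ltac:(lra))).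
        apply Rmult_le_compat_l; [trivial|]. apply clamp_lipschitz; lra.
Qed.

(** Cutting [0, 1] into N equal parts bounds the total increment by N C / N^2 = C / N, for every
    N. *)
Lemma quad_increment_constant (f : R -> X) C :
  (forall s t, 0 <= s <= t -> t <= 1 -> norm (minus (f t) (f s)) <= C * (t - s) ^ 2) -> f 1 = f 0.
Proof.
  intros Hf.
  assert (H : forall n : nat, norm (minus (f 1) (f 0)) <= C / INR (S n)).
  { intros n. set (N := INR (S n)).
    assert (HN : 0 < N) by (apply lt_0_INR; lia).
    assert (Hk : forall k, (k <= S n)%nat -> norm (minus (f (INR k / N)) (f 0)) <= INR k * (C / N ^ 2)).
    { induction k as [|k IH]; intros Hk.
      - simpl INR. unfold Rdiv. rewrite Rmult_0_l. rewrite minus_self, norm0; lra.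
      - assert (HkN : INR (S k) <= N) by (apply le_INR; trivial).
        rewrite S_INR in *. specialize (IH ltac:(lia)). pose proof (pos_INR k).
        apply Rle_trans with (1 := norm_minus_trans _ (f (INR k / N)) _).
        assert (Hstep := Hf (INR k / N) ((INR k + 1) / N)).
        replace ((INR k + 1) / N - INR k / N) with (/ N) in Hstep by (field; lra).
        assert (0 < / N) by (apply Rinv_0_lt_compat; trivial).
        assert (H1 : norm (minus (f ((INR k + 1) / N)) (f (INR k / N))) <= C * (/ N) ^ 2).
        { apply Hstep.
          - split; [apply Rdiv_le_0_compat; trivial|].
            apply Rmult_le_compat_r; lra.
          - apply (Rmult_le_reg_r N); trivial. unfold Rdiv.
            rewrite Rmult_assoc, Rinv_l; lra. }
        replace (C * (/ N) ^ 2) with (C / N ^ 2) in H1 by (field; lra). lra. }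
    specialize (Hk (S n) (le_n _)). fold N in Hk.
    replace (N / N) with 1 in Hk by (field; lra).
    replace (N * (C / N ^ 2)) with (C / N) in Hk by (field; lra). exact Hk. }
  assert (H0 : norm (minus (f 1) (f 0)) = 0).
  { apply Rle_antisym; [|apply norm_ge_0]. apply le_epsilon. intros e He.
    destruct (nfloor_ex (Rabs C / e)) as [n [_ Hn]]; [apply Rdiv_le_0_compat; trivial; apply Rabs_pos|].
    apply Rle_trans with (1 := H n). rewrite S_INR. pose proof (pos_INR n).
    apply (Rmult_le_reg_r (INR n + 1)); [lra|].
    replace (C / (INR n + 1) * (INR n + 1)) with C by (field; lra).
    pose proof (Rle_abs C). replace (Rabs C) with (Rabs C / e * e) in H1 by (field; lra). nra. }
  assert (Hz : minus (f 1) (f 0) = zero) by exact (norm_eq_zero _ H0).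
  replace (f 1) with (plus (minus (f 1) (f 0)) (f 0)) by vring. rewrite Hz. vring.
Qed.

(** The difference [phi] of the two sides, followed along the segment, has quadratically small
    increments and is therefore constant. The trivial weight [th ^ 0] matches the averages with
    weight [th ^ k] used below. *)
Lemma quad_FTC a b n L F x0 x : quad_chain a b (S n) L F -> 0 <= L ->
  a <= x0 <= b -> a <= x <= b ->
  minus (F O x) (F O x0) = scal (x - x0) (RInt (fun th => scal (th ^ 0) (F 1%nat (x0 + th * (x - x0)))) 0 1).
Proof.
  intros HF HL Hx0 Hx.
  set (g := fun th => scal (th ^ 0) (F 1%nat (x0 + th * (x - x0)))).
  assert (Hex : forall s t, 0 <= s <= 1 -> 0 <= t <= 1 -> ex_RInt g s t).
  { intros s t Hs Ht. apply ex_RInt_segment with a b L; trivial.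
    intros y z Hy Hz. apply (HF y z Hy Hz); lia. }
  set (phi := fun t => minus (F O (x0 + t * (x - x0))) (scal (x - x0) (RInt g 0 t))).
  assert (H : phi 1 = phi 0).
  { apply quad_increment_constant with (2 * L * (x - x0) ^ 2). intros s t Hs Ht.
    assert (HC : RInt g 0 t = plus (RInt g 0 s) (RInt g s t)).
    { symmetry. apply (RInt_Chasles (V := X)); apply Hex; lra. }
    set (xs := x0 + s * (x - x0)). set (xt := x0 + t * (x - x0)).
    assert (Hxs : a <= xs <= b) by (apply segment_in; trivial; lra).
    assert (Hxt : a <= xt <= b) by (apply segment_in; trivial; lra).
    assert (Hd : xt - xs = (t - s) * (x - x0)) by (unfold xt, xs; ring).
    assert (Hi : RInt (fun th => minus (g th) (F 1%nat xs)) s t =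
      minus (RInt g s t) (scal (t - s) (F 1%nat xs))).
    { etransitivity; [apply RInt_vminus; [apply Hex; lra|apply ex_RInt_const]|].
      rewrite RInt_const. reflexivity. }
    replace (minus (phi t) (phi s)) with
      (minus (minus (minus (F O xt) (F O xs)) (scal (xt - xs) (F 1%nat xs)))
        (scal (x - x0) (minus (RInt g s t) (scal (t - s) (F 1%nat xs))))).
    2:{ unfold phi. fold xt xs. rewrite HC, Hd. vring. }
    (* One [L] is the second-order remainder of [F 0], the other the Lipschitz error of [F 1] under
       the integral. *)
    replace (2 * L * (x - x0) ^ 2 * (t - s) ^ 2) with
      (L * (xt - xs) ^ 2 + Rabs (x - x0) * ((t - s) * (L * ((t - s) * Rabs (x - x0))))).
    2:{ rewrite Hd. replace ((x - x0) ^ 2) with (Rabs (x - x0) ^ 2) by apply pow2_abs.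
      replace (((t - s) * (x - x0)) ^ 2) with ((t - s) ^ 2 * (Rabs (x - x0)) ^ 2)
        by (rewrite pow2_abs; ring). ring. }
    apply norm_minus_le.
    - apply (HF xs xt Hxs Hxt); lia.
    - rewrite norm_scal_R. apply Rmult_le_compat_l; [apply Rabs_pos|].
      rewrite <- Hi. apply norm_RInt_bound; [lra| |].
      + apply ex_RInt_vminus; [apply Hex; lra|apply ex_RInt_const].
      + intros th Hth. unfold g. replace (scal (th ^ 0) (F 1%nat (x0 + th * (x - x0)))) with
          (F 1%nat (x0 + th * (x - x0))) by (simpl; vring).
        apply Rle_trans with (L * Rabs (x0 + th * (x - x0) - xs)).
        * apply (HF xs (x0 + th * (x - x0)) Hxs); [apply segment_in; trivial; lra|lia].
        * apply Rmult_le_compat_l; trivial. unfold xs.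
          replace (x0 + th * (x - x0) - (x0 + s * (x - x0))) with ((th - s) * (x - x0)) by ring.
          rewrite Rabs_mult, (Rabs_pos_eq (th - s)) by lra.
          apply Rmult_le_compat_r; [apply Rabs_pos|lra]. }
  unfold phi in H. rewrite RInt_point in H.
  replace (x0 + 1 * (x - x0)) with x in H by ring.
  replace (x0 + 0 * (x - x0)) with x0 in H by ring.
  set (I := RInt g 0 1) in *.
  replace (F O x) with (plus (minus (F O x) (scal (x - x0) I)) (scal (x - x0) I)) by vring.
  rewrite H. vring.
Qed.

(* Dividing by [x - x0], where [x0] is the last node, removes that node and costs one derivative:
   the quotient is the average of [F 1] over the segment from [x0] to [x]. *)
Lemma vanishing_bound n : forall a b L K (F : nat -> R -> X) (p : nat -> R), a <= b -> 0 <= L ->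
  quad_chain a b n L F ->
  (forall x y, a <= x <= b -> a <= y <= b -> norm (minus (F n y) (F n x)) <= K * Rabs (y - x)) ->
  (forall i, (i <= n)%nat -> a <= p i <= b) ->
  (forall i j, (i <= n)%nat -> (j <= n)%nat -> i <> j -> p i <> p j) ->
  (forall i, (i <= n)%nat -> F O (p i) = zero) -> 0 <= K ->
  forall x, a <= x <= b -> norm (F O x) <= K * (b - a) ^ S n.
Proof.
  induction n as [|n IH]; intros a b L K F p Hab HL HF HK Hp Hinj Hz HK0 x Hx.
  - replace (F O x) with (minus (F O x) (F O (p O))) by (rewrite (Hz O) by lia; vring).
    apply Rle_trans with (1 := HK _ _ (Hp O ltac:(lia)) Hx).
    apply Rmult_le_compat_l; trivial. specialize (Hp O ltac:(lia)).
    simpl. rewrite Rmult_1_r. apply Rabs_le; lra.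
  - set (x0 := p (S n)). assert (Hx0 : a <= x0 <= b) by (apply Hp; lia).
    (* [G k] plays the k-th derivative of the divided difference [G 0]: each differentiation in [y]
       under the integral brings out a factor [th]. *)
    set (G := fun k y => RInt (fun th => scal (th ^ k) (F (S k) (x0 + th * (y - x0)))) 0 1).
    assert (Hex : forall k y, (k <= n)%nat -> a <= y <= b ->
      ex_RInt (fun th => scal (th ^ k) (F (S k) (x0 + th * (y - x0)))) 0 1).
    { intros k y Hk Hy. apply ex_RInt_segment with a b L; trivial; try lra.
      intros u v Hu Hv. apply (HF u v Hu Hv); lia. }
    assert (Hpow : forall th k, 0 <= th <= 1 -> 0 <= th ^ k <= 1).
    { intros th k Hth. split; [apply pow_le; lra|]. rewrite <- (pow1 k). apply pow_incr; lra. }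
    assert (HGd : forall k y z C, (k <= n)%nat -> a <= y <= b -> a <= z <= b -> 0 <= C ->
      (forall u v, a <= u <= b -> a <= v <= b -> norm (minus (F (S k) v) (F (S k) u)) <= C * Rabs (v - u)) ->
      norm (minus (G k z) (G k y)) <= C * Rabs (z - y)).
    { intros k y z C Hk Hy Hz' HC HFC. unfold G.
      rewrite <- RInt_vminus by (apply Hex; trivial).
      replace (C * Rabs (z - y)) with ((1 - 0) * (C * Rabs (z - y))) by ring.
      apply norm_RInt_bound; [lra|apply ex_RInt_vminus; apply Hex; trivial|].
      intros th Hth.
      set (u := x0 + th * (y - x0)). set (v := x0 + th * (z - x0)).
      norm_as (scal (th ^ k) (minus (F (S k) v) (F (S k) u))); [vring|].
      rewrite norm_scal_R. pose proof (Hpow th k Hth). rewrite Rabs_pos_eq by lra.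
      assert (H1 := HFC u v (segment_in _ _ _ _ _ Hx0 Hy Hth) (segment_in _ _ _ _ _ Hx0 Hz' Hth)).
      replace (v - u) with (th * (z - y)) in H1 by (unfold u, v; ring).
      rewrite Rabs_mult, (Rabs_pos_eq th) in H1 by lra.
      assert (0 <= C * Rabs (z - y)) by (apply Rmult_le_pos; [trivial|apply Rabs_pos]).
      assert (C * (th * Rabs (z - y)) <= C * Rabs (z - y)) by nra.
      pose proof (norm_ge_0 (minus (F (S k) v) (F (S k) u))). nra. }
    assert (HG : quad_chain a b n L G).
    { intros y z Hy Hz'. split.
      - intros k Hk. unfold G.
        set (I1 := fun th => scal (th ^ k) (F (S k) (x0 + th * (z - x0)))).
        set (I2 := fun th => scal (th ^ k) (F (S k) (x0 + th * (y - x0)))).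
        set (I3 := fun th => scal (th ^ S k) (F (S (S k)) (x0 + th * (y - x0)))).
        assert (E1 : ex_RInt I1 0 1) by (apply Hex; trivial; lia).
        assert (E2 : ex_RInt I2 0 1) by (apply Hex; trivial; lia).
        assert (E3 : ex_RInt I3 0 1) by (apply Hex; trivial; lia).
        assert (E4 : ex_RInt (fun th => minus (I1 th) (I2 th)) 0 1)
          by (apply ex_RInt_vminus; trivial).
        assert (E5 : ex_RInt (fun th => scal (z - y) (I3 th)) 0 1)
          by (apply (ex_RInt_vscal); trivial).
        assert (E6 : RInt (fun th => minus (minus (I1 th) (I2 th)) (scal (z - y) (I3 th))) 0 1 =
          minus (minus (RInt I1 0 1) (RInt I2 0 1)) (scal (z - y) (RInt I3 0 1))).
        { etransitivity; [apply (RInt_vminus _ _ _ _ E4 E5)|].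
          rewrite (RInt_vscal I3) by trivial.
          rewrite (RInt_vminus I1 I2) by trivial. reflexivity. }
        rewrite <- E6.
        replace (L * (z - y) ^ 2) with ((1 - 0) * (L * (z - y) ^ 2)) by ring.
        apply norm_RInt_bound; [lra|apply ex_RInt_vminus; trivial|].
        intros th Hth. unfold I1, I2, I3.
        set (u := x0 + th * (y - x0)). set (v := x0 + th * (z - x0)).
        assert (Huv : v - u = th * (z - y)) by (unfold u, v; ring).
        norm_as (scal (th ^ k) (minus (minus (F (S k) v) (F (S k) u)) (scal (v - u) (F (S (S k)) u))));
          [rewrite Huv; simpl pow; vring|].
        rewrite norm_scal_R. pose proof (Hpow th k Hth). rewrite Rabs_pos_eq by lra.
        destruct (HF u v (segment_in _ _ _ _ _ Hx0 Hy Hth) (segment_in _ _ _ _ _ Hx0 Hz' Hth))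
          as [H1 _].
        specialize (H1 (S k) ltac:(lia)). rewrite Huv in H1. rewrite Huv.
        replace (L * (z - y) ^ 2) with (1 * (L * (z - y) ^ 2)) by ring.
        apply Rmult_le_compat; [lra|apply norm_ge_0|lra|].
        apply Rle_trans with (1 := H1).
        replace ((th * (z - y)) ^ 2) with (th ^ 2 * (z - y) ^ 2) by ring.
        pose proof (Hpow th 2%nat Hth). pose proof (pow2_ge_0 (z - y)).
        apply Rmult_le_compat_l; nra.
      - intros k Hk. apply HGd; trivial. intros u v Hu Hv. apply (HF u v Hu Hv); lia. }
    assert (Hfac : forall y, a <= y <= b -> F O y = scal (y - x0) (G O y)).
    { intros y Hy. unfold G. rewrite <- (quad_FTC a b n L F x0 y HF HL Hx0 Hy).
      unfold x0. rewrite (Hz (S n)) by lia. vring. }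
    rewrite Hfac, norm_scal_R by trivial.
    replace (K * (b - a) ^ S (S n)) with ((b - a) * (K * (b - a) ^ S n)) by (simpl; ring).
    apply Rmult_le_compat; [apply Rabs_pos|apply norm_ge_0|apply Rabs_le; lra|].
    apply (IH a b L K G p); trivial.
    + intros y z Hy Hz'. apply HGd; trivial.
    + intros i Hi; apply Hp; lia.
    + intros i j Hi Hj; apply Hinj; lia.
    (* The remaining nodes differ from [x0], so the quotient vanishes there together with [F 0]. *)
    + intros i Hi. assert (Hne : p i - x0 <> 0).
      { unfold x0. apply Rminus_eq_contra, Hinj; lia. }
      replace (G O (p i)) with (scal (/ (p i - x0)) (scal (p i - x0) (G O (p i)))) by vfield.
      rewrite <- Hfac by (apply Hp; lia). rewrite Hz by lia. vring.
Qed.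

End Calculus.

(** * Interpolation error *)

(** The k-th derivative of y^j. Once the exponent has dropped to 0 the factor [INR 0] annihilates
    the rest, so the truncated [pred] is harmless. *)
Fixpoint pow_deriv (k j : nat) (y : R) : R :=
  match k with O => y ^ j | S m => INR j * pow_deriv m (pred j) y end.

Lemma is_derive_pow_deriv k : forall j y, is_derive (pow_deriv k j) y (pow_deriv (S k) j y).
Proof.
  induction k as [|k IH]; intros j y; simpl.
  - auto_derive; trivial. ring.
  - apply (is_derive_scal (pow_deriv k (pred j)) y (INR j)). apply IH.
Qed.

Lemma pow_deriv_high k : forall j y, (j < k)%nat -> pow_deriv k j y = 0.
Proof.
  induction k as [|k IH]; intros [|j] y H; simpl pow_deriv; try lia.
  - simpl; ring.
  - rewrite IH by (simpl; lia). ring.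
Qed.

(** Written over a list with [fold_right] so as to be convertible with the integrand of the
    quadrature condition. *)
Definition node_prod (p : nat -> R) (l : list nat) (y : R) : R :=
  fold_right Rmult 1 (map (fun i => y - p i) l).

Lemma node_prod_derivs p l : exists W : nat -> R -> R,
  (forall y, W O y = node_prod p l y) /\
  (forall k y, is_derive (W k) y (W (S k) y)) /\
  (forall y, W (length l) y = INR (fact (length l))) /\
  (forall y, W (S (length l)) y = 0).
Proof.
  induction l as [|i l (W & H0 & Hd & Hl & HSl)].
  - exists (fun k y => match k with O => 1 | _ => 0 end).
    split; [trivial|split; [|split; trivial]].
    intros [|k] y; apply (is_derive_const (K := R_AbsRing) (V := R_NormedModule)).
  (* Leibniz's rule for a product with an affine factor; at k = 0 the second term is removed by
     [INR 0]. *)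
  - exists (fun k y => (y - p i) * W k y + INR k * W (pred k) y).
    split; [|split; [|split]].
    + intros y. unfold node_prod. simpl. rewrite H0. unfold node_prod. ring.
    + intros k y.
      assert (Hex : forall k, ex_derive (W k) y) by (intros m; eexists; apply Hd).
      assert (HD : forall m, Derive (fun x => W m x) y = W (S m) y)
        by (intros m; apply is_derive_unique, Hd).
      auto_derive; [repeat split; apply Hex|].
      rewrite !HD. destruct k as [|k]; simpl pred; rewrite ?S_INR; simpl INR; ring.
    + intros y. simpl length. rewrite HSl. simpl pred. rewrite Hl.
      change (fact (S (length l))) with (S (length l) * fact (length l))%nat.
      rewrite mult_INR. ring.
    + intros y. simpl length. simpl pred. rewrite HSl.
      assert (H : is_derive (W (S (length l))) y 0).
      { apply (is_derive_ext (fun _ => 0)); [intros; symmetry; apply HSl|].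
        apply (is_derive_const (K := R_AbsRing) (V := R_NormedModule)). }
      rewrite <- (is_derive_unique _ _ _ (Hd (S (length l)) y)), (is_derive_unique _ _ _ H). ring.
Qed.

Lemma node_prod_root p l i : In i l -> node_prod p l (p i) = 0.
Proof.
  unfold node_prod. induction l as [|j l IH]; simpl; [tauto|].
  intros [->|H]; [ring|rewrite IH by trivial; ring].
Qed.

Lemma is_derive_bounded (g g' : R -> R) a b : a <= b -> (forall y, is_derive g y (g' y)) ->
  exists B, 0 <= B /\ forall y, a <= y <= b -> Rabs (g y) <= B.
Proof.
  intros Hab Hg.
  destruct (continuity_ab_maj (fun y => Rabs (g y)) a b Hab) as (m & Hm & _).
  { intros c _. apply (continuity_pt_comp g Rabs); [|apply Rcontinuity_abs].
    apply continuity_pt_filterlim, (ex_derive_continuous (K := R_AbsRing) (V := R_NormedModule)).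
    eexists; apply Hg. }
  exists (Rabs (g m)); split; [apply Rabs_pos|exact Hm].
Qed.

Section Interpolation.
Context {X : CompleteNormedModule R_AbsRing}.

Lemma vsum_scal_bounded (g g' : nat -> R -> R) (v : nat -> X) n a b : a <= b ->
  (forall j y, is_derive (g j) y (g' j y)) ->
  exists B, 0 <= B /\ forall y, a <= y <= b -> norm (vsum (fun j => scal (g j y) (v j)) n) <= B.
Proof.
  intros Hab Hg. induction n as [|n (B & HB & Hn)].
  - exists 0; split; [lra|]. intros y _. simpl. rewrite norm0. lra.
  - destruct (is_derive_bounded (g n) (g' n) a b Hab (Hg n)) as (C & HC & Hb).
    exists (B + C * norm (v n)). pose proof (norm_ge_0 (v n)). split; [nra|].
    intros y Hy. apply norm_plus_le; [apply Hn, Hy|].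
    rewrite norm_scal_R. apply Rmult_le_compat_r; trivial. apply Hb, Hy.
Qed.

Lemma uniform_bound (P : nat -> R -> Prop) n : (forall k B C, P k B -> B <= C -> P k C) ->
  (forall k, (k <= n)%nat -> exists B, 0 <= B /\ P k B) ->
  exists B, 0 <= B /\ forall k, (k <= n)%nat -> P k B.
Proof.
  intros Hm. induction n as [|n IH]; intros H.
  - destruct (H O (le_n _)) as (B & HB & HP). exists B; split; trivial.
    intros k Hk. replace k with O by lia. trivial.
  - destruct IH as (B & HB & HP); [intros; apply H; lia|].
    destruct (H (S n) (le_n _)) as (C & HC & HPC).
    exists (B + C); split; [lra|]. intros k Hk.
    destruct (Nat.eq_dec k (S n)) as [->|Hne].
    + apply Hm with C; trivial; lra.
    + apply Hm with B; [apply HP; lia|lra].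
Qed.

(** The corrected error [F 0] vanishes at the nodes, and its derivative of order nu is h^(nu) - z:
    the interpolant has degree below nu, and the node product has constant derivative nu!. Taking z
    = 0 gives the plain error bound, taking z close to h^(nu) isolates the leading term. *)
Lemma interpolation_error nu hd a b (p : nat -> R) (al : nat -> X) (z : X) K :
  (1 <= nu)%nat -> 0 <= a <= b -> 0 <= K ->
  (forall k x, (k < nu)%nat -> 0 <= x -> deriv_on_nonneg (hd k) x (hd (S k) x)) ->
  (forall k, (1 <= k <= nu)%nat -> exists M, forall x, 0 <= x -> norm (hd k x) <= M) ->
  (forall i, (i < nu)%nat -> a <= p i <= b) ->
  (forall i j, (i < nu)%nat -> (j < nu)%nat -> i <> j -> p i <> p j) ->
  (forall i, (i < nu)%nat -> vsum (fun j => scal (p i ^ j) (al j)) nu = hd O (p i)) ->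
  (forall y, a <= y <= b -> norm (minus (hd nu y) z) <= K) ->
  forall y, a <= y <= b ->
    norm (minus (minus (hd O y) (vsum (fun j => scal (y ^ j) (al j)) nu))
      (scal (node_prod p (seq 0 nu) y / INR (fact nu)) z)) <= K * (b - a) ^ nu.
Proof.
  intros Hnu Hab HK0 Hd Hb Hp Hinj Hint HK y Hy.
  destruct (node_prod_derivs p (seq 0 nu)) as (W & HW0 & HWd & HWn & _).
  rewrite length_seq in HWn.
  assert (Hfact : INR (fact nu) <> 0) by apply INR_fact_neq_0.
  set (F := fun k y => minus (minus (hd k y) (vsum (fun j => scal (pow_deriv k j y) (al j)) nu))
      (scal (W k y / INR (fact nu)) z)).
  assert (HFd : forall k x, (k < nu)%nat -> 0 <= x -> deriv_on_nonneg (F k) x (F (S k) x)).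
  { intros k x Hk Hx. unfold F. apply deriv_minus; trivial; [apply deriv_minus; trivial|].
    - apply Hd; trivial.
    - apply deriv_vsum; trivial. intros j _. apply is_derive_pow_deriv.
    - apply (deriv_scal (fun y => W k y / INR (fact nu))); trivial.
      apply (is_derive_ext (fun y => / INR (fact nu) * W k y)); [intros; apply Rmult_comm|].
      unfold Rdiv. rewrite Rmult_comm.
      apply (is_derive_scal (W k) x (/ INR (fact nu))). apply HWd. }
  assert (HFn : forall x, F nu x = minus (hd nu x) z).
  { intros x. unfold F. rewrite HWn.
    assert (H0 : forall n, (n <= nu)%nat ->
      vsum (fun j => scal (pow_deriv nu j x) (al j)) n = (zero : X)).
    { induction n as [|n IHn]; intros Hn; simpl; trivial.
      rewrite IHn, pow_deriv_high by lia. vring. }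
    rewrite H0 by trivial. vfield. }
  (* This bound depends on the interval and on the coefficients; it only serves to establish
     [quad_chain], and the final estimate contains [K] alone. *)
  assert (HB : exists B, 0 <= B /\ forall k, (k <= nu - 1)%nat ->
    forall x, a <= x <= b -> norm (F (S k) x) <= B).
  { apply (uniform_bound (fun k B => forall x, a <= x <= b -> norm (F (S k) x) <= B)).
    - intros k B C H HBC x Hx. apply Rle_trans with (1 := H x Hx), HBC.
    - intros k Hk.
      destruct (Hb (S k)) as (B1 & H1); [lia|].
      destruct (vsum_scal_bounded (fun j => pow_deriv (S k) j) (fun j => pow_deriv (S (S k)) j)
        al nu a b (proj2 Hab) (fun j x => is_derive_pow_deriv (S k) j x)) as (B2 & HB2 & H2).
      destruct (is_derive_bounded (W (S k)) (W (S (S k))) a b (proj2 Hab) (HWd (S k)))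
        as (B3 & HB3 & H3).
      exists (Rabs B1 + B2 + B3 / INR (fact nu) * norm z).
      assert (Hf0 : 0 < / INR (fact nu)) by (apply Rinv_0_lt_compat, INR_fact_lt_0).
      pose proof (norm_ge_0 z). pose proof (Rabs_pos B1).
      split; [unfold Rdiv; assert (0 <= B3 * / INR (fact nu)) by nra; nra|].
      intros x Hx. unfold F. apply norm_minus_le; [apply norm_minus_le|].
      + apply Rle_trans with B1; [apply H1; lra|apply Rle_abs].
      + apply H2, Hx.
      + rewrite norm_scal_R. apply Rmult_le_compat_r; trivial.
        unfold Rdiv. rewrite Rabs_mult, (Rabs_pos_eq (/ _)) by lra.
        apply Rmult_le_compat_r; [lra|]. apply H3, Hx. }
  destruct HB as (L & HL & HLb).
  assert (Hlip : forall k x u, (k <= nu - 1)%nat -> a <= x <= b -> a <= u <= b ->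
    norm (minus (F k u) (F k x)) <= L * Rabs (u - x)).
  { intros k x u Hk Hx Hu. apply mean_value_inequality_abs with (F (S k)) a b; trivial; [lra|].
    intros w Hw. split; [apply HFd; [lia|lra]|apply HLb; trivial]. }
  change (norm (minus (minus (hd O y) (vsum (fun j => scal (pow_deriv O j y) (al j)) nu))
      (scal (node_prod p (seq 0 nu) y / INR (fact nu)) z)) <= K * (b - a) ^ nu).
  rewrite <- HW0. change (norm (F O y) <= K * (b - a) ^ nu).
  replace nu with (S (nu - 1)) at 1 by lia.
  apply (vanishing_bound (nu - 1) a b L K F p); trivial; try lra.
  - intros x u Hx Hu. split; [|intros; apply Hlip; trivial].
    intros k Hk.
    (* The derivative of [g] is the increment of [F (S k)] from [x], of size at most
       [L * Rabs (u - x)] between [x] and [u]; the mean value inequality supplies the second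
       factor. *)
    set (g := fun w => minus (F k w) (scal (w - x) (F (S k) x))).
    norm_as (minus (g u) (g x)); [unfold g; vring|].
    replace (L * (u - x) ^ 2) with ((L * Rabs (u - x)) * Rabs (u - x))
      by (rewrite <- (pow2_abs (u - x)); ring).
    assert (Hmm : a <= Rmin u x /\ Rmax u x <= b)
      by (unfold Rmin, Rmax; destruct Rle_dec; lra).
    apply mean_value_inequality_abs with (fun w => minus (F (S k) w) (scal 1 (F (S k) x)))
      (Rmin u x) (Rmax u x); try lra;
      try (unfold Rmin, Rmax; destruct Rle_dec; lra).
    intros w Hw. split.
    + apply deriv_minus; [lra|apply HFd; [lia|lra]|].
      apply (deriv_scal (fun w => w - x)); [lra|]. auto_derive; trivial; ring.
    + norm_as (minus (F (S k) w) (F (S k) x)); [vring|].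
      apply Rle_trans with (1 := Hlip (S k) x w ltac:(lia) Hx ltac:(lra)).
      apply Rmult_le_compat_l; trivial.
      revert Hw; unfold Rmin, Rmax, Rabs; destruct Rle_dec; repeat destruct Rcase_abs; lra.
  (* Here h^(nu) - z enters, as the Lipschitz constant of the derivative of order nu - 1. *)
  - intros x u Hx Hu. apply mean_value_inequality_abs with (F (S (nu - 1))) a b; trivial; [lra|].
    intros w Hw. split; [apply HFd; [lia|lra]|].
    replace (S (nu - 1)) with nu by lia. rewrite HFn. apply HK, Hw.
  - intros i Hi. apply Hp; lia.
  - intros i j Hi Hj. apply Hinj; lia.
  - intros i Hi. unfold F. simpl pow_deriv. rewrite Hint, HW0, node_prod_root by
      (try apply in_seq; lia). unfold Rdiv. vring.
Qed.

End Interpolation.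

(** * The scheme as variation of constants *)

Lemma rpow_pos x a : 0 < x -> rpow x a = Rpower x a.
Proof. intros; unfold rpow; destruct Rlt_dec; [trivial|contradiction]. Qed.

Lemma rpow_nonpos x a : x <= 0 -> a <> 0 -> rpow x a = 0.
Proof. intros; unfold rpow; destruct Rlt_dec; [lra|]. destruct Req_EM_T; [contradiction|trivial]. Qed.

Lemma rpow_0_r x : rpow x 0 = 1.
Proof.
  unfold rpow. destruct Rlt_dec; [apply Rpower_O; trivial|]. destruct Req_EM_T; [trivial|contradiction].
Qed.

Lemma rpow_ge_0 x a : 0 <= rpow x a.
Proof.
  unfold rpow. destruct Rlt_dec; [left; apply exp_pos|]. destruct Req_EM_T; lra.
Qed.

Lemma continuous_rpow a x : 0 <= a -> continuous (fun x => rpow x a) x.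
Proof.
  intros Ha. destruct (Req_dec a 0) as [->|Hn].
  { apply (continuous_ext (fun _ => 1)); [intros; symmetry; apply rpow_0_r|].
    apply continuous_const. }
  destruct (total_order_T x 0) as [[Hx| ->]|Hx].
  - apply (continuous_ext_loc _ (fun _ => 0)); [|apply continuous_const].
    exists (mkposreal (- x) ltac:(lra)). intros y Hy.
    change (Rabs (y - x) < - x) in Hy. symmetry; apply rpow_nonpos; trivial.
    revert Hy; unfold Rabs; destruct Rcase_abs; lra.
  - apply filterlim_locally. intros e.
    exists (mkposreal (Rpower e (/ a)) (exp_pos _)). intros y Hy.
    change (Rabs (y - 0) < Rpower e (/ a)) in Hy.
    change (Rabs (rpow y a - rpow 0 a) < e).
    rewrite (rpow_nonpos 0), Rminus_0_r, Rabs_pos_eq by (try apply rpow_ge_0; lra).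
    destruct (Rle_lt_dec y 0) as [H|H].
    + rewrite rpow_nonpos by trivial. apply cond_pos.
    + rewrite rpow_pos by trivial. rewrite Rminus_0_r, Rabs_pos_eq in Hy by lra.
      replace (pos e) with (Rpower (Rpower e (/ a)) a).
      * apply Rlt_Rpower_l; lra.
      * rewrite Rpower_mult, Rinv_l, Rpower_1; trivial. apply cond_pos.
  - apply (continuous_ext_loc _ (fun x => Rpower x a)).
    + exists (mkposreal x Hx). intros y Hy. change (Rabs (y - x) < x) in Hy.
      symmetry; apply rpow_pos. revert Hy; unfold Rabs; destruct Rcase_abs; lra.
    + apply (ex_derive_continuous (K := R_AbsRing) (V := R_NormedModule)).
      unfold Rpower. auto_derive; trivial.
Qed.

(** This turns the interpolation conditions into polynomial ones in s^r. It holds at s = 0 too,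
    where the term j = 0 relies on [rpow 0 0 = 1]. *)
Lemma rpow_rpow_pow s r j : 0 < r -> rpow s r ^ j = rpow s (INR j * r).
Proof.
  intros Hr. destruct (Rle_lt_dec s 0) as [H|H].
  - rewrite rpow_nonpos by (trivial; lra). destruct j as [|j].
    + simpl. rewrite Rmult_0_l, rpow_0_r. trivial.
    + rewrite rpow_nonpos; trivial; [simpl; ring|].
      apply Rgt_not_eq, Rmult_lt_0_compat; trivial. apply lt_0_INR; lia.
  - rewrite !rpow_pos by trivial. rewrite <- Rpower_pow by apply exp_pos.
    rewrite Rpower_mult. f_equal; ring.
Qed.

Lemma rpow_mult_l s t a : 0 < s -> 0 < t -> rpow (s * t) a = rpow s a * rpow t a.
Proof.
  intros; rewrite !rpow_pos by (trivial; apply Rmult_lt_0_compat; trivial).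
  symmetry; apply Rpower_mult_distr; trivial.
Qed.

(** * Euler's Gamma function *)

Lemma RInt_gen_0_infty (f : R -> R) L : (forall x, continuous f x) ->
  (forall e, 0 < e -> exists B, forall b, B < b -> Rabs (RInt f 0 b - L) < e) ->
  RInt_gen f (at_right 0) (Rbar_locally p_infty) = L.
Proof.
  intros Hf HL.
  assert (Hex : forall a b, ex_RInt f a b)
    by (intros; apply (ex_RInt_continuous (V := R_CompleteNormedModule)); intros; apply Hf).
  apply (is_RInt_gen_unique (V := R_CompleteNormedModule)).
  intros P HP. destruct HP as [e HP].
  destruct (HL (e / 2)) as [B HB]; [pose proof (cond_pos e); lra|].
  assert (H0 : continuous (fun x => RInt f 0 x) 0).
  { apply (ex_derive_continuous (K := R_AbsRing) (V := R_NormedModule)). eexists.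
    apply (is_derive_RInt f _ 0 0); [|apply Hf].
    apply filter_forall. intros y. apply (RInt_correct (V := R_CompleteNormedModule)), Hex. }
  destruct (proj1 (filterlim_locally _ _) H0 (mkposreal (e / 2) ltac:(pose proof (cond_pos e); lra)))
    as [d Hd].
  apply (Filter_prod _ _ _ (fun x => 0 < x < d) (fun y => B < y)).
  - exists d. intros y Hy H. change (Rabs (y - 0) < d) in Hy.
    rewrite Rminus_0_r, Rabs_pos_eq in Hy; lra.
  - exists B. trivial.
  - intros x y Hx Hy. exists (RInt f x y). split.
    + apply (RInt_correct (V := R_CompleteNormedModule)), Hex.
    + apply HP. change (Rabs (RInt f x y - L) < e). specialize (HB y Hy).
      assert (Hc := RInt_Chasles (V := R_CompleteNormedModule) f 0 x y (Hex _ _) (Hex _ _)).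
      change (RInt f 0 x + RInt f x y = RInt f 0 y) in Hc.
      assert (Hdx : Rabs (RInt f 0 x - RInt f 0 0) < e / 2).
      { apply (Hd x). change (Rabs (x - 0) < d). rewrite Rminus_0_r, Rabs_pos_eq; lra. }
      rewrite RInt_point in Hdx. change (Rabs (RInt f 0 x - 0) < e / 2) in Hdx.
      revert HB Hdx. unfold Rabs; repeat destruct Rcase_abs; lra.
Qed.

Lemma continuous_Gamma_integrand a : 0 <= a -> forall x, continuous (fun t => rpow t a * exp (- t)) x.
Proof.
  intros Ha x. apply (continuous_mult (fun t => rpow t a) (fun t => exp (- t))).
  - apply continuous_rpow, Ha.
  - apply (ex_derive_continuous (K := R_AbsRing) (V := R_NormedModule)). auto_derive; trivial.
Qed.

Lemma RInt_exp_scaled k b : k <> 0 -> RInt (fun t => exp (- k * t)) 0 b = (1 - exp (- k * b)) / k.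
Proof.
  intros Hk. apply is_RInt_unique.
  replace ((1 - exp (- k * b)) / k) with (minus (- exp (- k * b) / k) (- exp (- k * 0) / k)).
  - apply (is_RInt_derive (fun t => - exp (- k * t) / k)).
    + intros t _. auto_derive; trivial. field; trivial.
    + intros t _. apply (ex_derive_continuous (K := R_AbsRing) (V := R_NormedModule)).
      auto_derive; trivial.
  - change (- exp (- k * b) / k - - exp (- k * 0) / k = (1 - exp (- k * b)) / k).
    rewrite Rmult_0_r, exp_0. field; trivial.
Qed.

Lemma Gamma_1 : Gamma 1 = 1.
Proof.
  unfold Gamma. apply RInt_gen_0_infty.
  { replace (1 - 1) with 0 by ring. apply continuous_Gamma_integrand; lra. }
  intros e He. exists (Rabs (ln e)). intros b Hb.
  rewrite (RInt_ext _ (fun t => exp (Ropp 1 * t))).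
  2:{ intros t _. replace (1 - 1) with 0 by ring. rewrite rpow_0_r, Rmult_1_l. f_equal; ring. }
  rewrite RInt_exp_scaled by lra.
  replace ((1 - exp (Ropp 1 * b)) / 1 - 1) with (- exp (- b)).
  2:{ replace (Ropp 1 * b) with (- b) by ring. field. }
  rewrite Rabs_Ropp, Rabs_pos_eq by (left; apply exp_pos).
  rewrite <- (exp_ln e He). apply exp_increasing.
  revert Hb; unfold Rabs; destruct Rcase_abs; lra.
Qed.

Lemma Gamma_integrand_bound a : 0 <= a ->
  exists C, 0 < C /\ forall t, 0 < t -> rpow t a * exp (- t) <= C * exp (- (1 / 2) * t).
Proof.
  intros Ha.
  assert (Hsplit : forall t, exp (- t) = exp (- (t / 2)) * exp (- (1 / 2) * t))
    by (intros u; rewrite <- exp_plus; f_equal; field).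
  destruct (Req_dec a 0) as [->|Hn].
  - exists 1; split; [lra|]. intros u Hu. rewrite rpow_0_r, Hsplit, <- Rmult_assoc.
    apply Rmult_le_compat_r; [left; apply exp_pos|]. rewrite Rmult_1_l, <- exp_0.
    left; apply exp_increasing; lra.
  (* (2a)^a bounds u^a exp(-u/2), by ln x <= x at x = u / (2a). *)
  - exists (exp (a * ln (2 * a))); split; [apply exp_pos|]. intros u Hu.
    rewrite rpow_pos, Hsplit, <- Rmult_assoc by trivial.
    apply Rmult_le_compat_r; [left; apply exp_pos|]. unfold Rpower. rewrite <- exp_plus.
    assert (H : ln (u / (2 * a)) <= u / (2 * a)).
    { assert (Hp : 0 < u / (2 * a)) by (apply Rdiv_lt_0_compat; lra).
      left. apply exp_lt_inv. rewrite exp_ln by trivial.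
      pose proof (exp_ineq1 (u / (2 * a)) ltac:(lra)). lra. }
    rewrite ln_div in H by lra.
    assert (Hle : a * ln u + - (u / 2) <= a * ln (2 * a)).
    { apply (Rmult_le_compat_l a) in H; [|lra].
      replace (a * (u / (2 * a))) with (u / 2) in H by (field; lra). lra. }
    destruct Hle as [Hle|Hle]; [left; apply exp_increasing; trivial|right; rewrite Hle; trivial].
Qed.

(** Allows the Gamma factors to be cancelled. The improper integral is the supremum of increasing
    bounded truncations, hence at least the positive integral over [0, 1]. *)
Lemma Gamma_pos lam : 1 <= lam -> 0 < Gamma lam.
Proof.
  intros Hl. set (f := fun t => rpow t (lam - 1) * exp (- t)).
  assert (Hf : forall x, continuous f x) by (apply continuous_Gamma_integrand; lra).
  assert (Hex : forall a b, ex_RInt f a b)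
    by (intros; apply (ex_RInt_continuous (V := R_CompleteNormedModule)); intros; apply Hf).
  destruct (Gamma_integrand_bound (lam - 1)) as (C & HC & Hb); [lra|].
  assert (Hpos : forall t, 0 <= f t)
    by (intros t; apply Rmult_le_pos; [apply rpow_ge_0|left; apply exp_pos]).
  assert (Hmono : forall x y, x <= y -> RInt f 0 x <= RInt f 0 y).
  { intros x y Hxy.
    assert (Hc := RInt_Chasles (V := R_CompleteNormedModule) f 0 x y (Hex _ _) (Hex _ _)).
    change (RInt f 0 x + RInt f x y = RInt f 0 y) in Hc.
    pose proof (RInt_ge_0 f x y Hxy (Hex x y) (fun t _ => Hpos t)). lra. }
  assert (Hbound : forall b, 0 <= b -> RInt f 0 b <= 2 * C).
  { intros b Hb0.
    apply Rle_trans with (RInt (fun t => C * exp (- (1 / 2) * t)) 0 b).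
    - apply RInt_le; trivial.
      + apply (ex_RInt_continuous (V := R_CompleteNormedModule)). intros z _.
        apply (ex_derive_continuous (K := R_AbsRing) (V := R_NormedModule)). auto_derive; trivial.
      + intros t Ht. apply Hb; lra.
    - assert (He := RInt_scal (V := R_CompleteNormedModule) (fun t => exp (- (1 / 2) * t)) 0 b C).
      change (ex_RInt (fun t => exp (- (1 / 2) * t)) 0 b ->
        RInt (fun t => C * exp (- (1 / 2) * t)) 0 b = C * RInt (fun t => exp (- (1 / 2) * t)) 0 b) in He.
      rewrite He.
      + rewrite RInt_exp_scaled by lra. pose proof (exp_pos (- (1 / 2) * b)).
        replace (2 * C) with (C * 2) by ring. apply Rmult_le_compat_l; lra.
      + apply (ex_RInt_continuous (V := R_CompleteNormedModule)). intros z _.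
        apply (ex_derive_continuous (K := R_AbsRing) (V := R_NormedModule)). auto_derive; trivial. }
  destruct (completeness (fun y => exists b, 0 <= b /\ y = RInt f 0 b)) as [L [Hub Hlub]].
  { exists (2 * C). intros y (b & Hb0 & ->). apply Hbound, Hb0. }
  { exists (RInt f 0 0), 0. split; [lra|trivial]. }
  assert (HG : Gamma lam = L).
  { change (RInt_gen f (at_right 0) (Rbar_locally p_infty) = L).
    apply (RInt_gen_0_infty f L Hf). intros e He.
    destruct (classic (exists b, 0 <= b /\ L - e < RInt f 0 b)) as [(B & HB & HLB)|Hno].
    - exists B. intros b Hbb. specialize (Hmono B b ltac:(lra)).
      assert (RInt f 0 b <= L) by (apply Hub; exists b; split; [lra|trivial]).
      unfold Rabs; destruct Rcase_abs; lra.
    - exfalso. assert (L <= L - e); [|lra]. apply Hlub. intros y (b & Hb0 & ->).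
      apply Rnot_lt_le. intros Hlt. apply Hno. exists b; split; trivial. }
  rewrite HG. apply Rlt_le_trans with (RInt f 0 1).
  - apply RInt_gt_0; [lra| |].
    + intros t Ht. unfold f. rewrite rpow_pos by lra. apply Rmult_lt_0_compat; apply exp_pos.
    + intros t _. apply Hf.
  - apply Hub. exists 1; split; [lra|trivial].
Qed.

(** * Integral form of the scheme and accumulation of the defects *)

Section Scheme.
Context {X : CompleteNormedModule R_AbsRing} (E : R -> X -> X).
Hypothesis HE : C0_semigroup E.

Lemma sg_ex_RInt (g : R -> X) a x y : (forall s, continuous g s) -> x <= y <= a ->
  ex_RInt (fun s => E (a - s) (g s)) x y.
Proof.
  intros Hg Hxy. apply (ex_RInt_ext (fun s => E (Rmax 0 (a - s)) (g s))).
  - intros s Hs. rewrite Rmax_right; trivial.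
    revert Hs; unfold Rmin, Rmax; destruct Rle_dec; lra.
  - apply (ex_RInt_continuous (V := X)). intros s _. apply sg_continuous_extension; trivial.
Qed.

Lemma sg_RInt_shift (g : R -> X) a x y tau : (forall s, continuous g s) -> x <= y <= a -> 0 <= tau ->
  E tau (RInt (fun s => E (a - s) (g s)) x y) = RInt (fun s => E (a + tau - s) (g s)) x y.
Proof.
  intros Hg Hxy Htau. rewrite sg_RInt; trivial; [|apply sg_ex_RInt; trivial].
  apply RInt_ext. intros s Hs.
  assert (s <= a) by (revert Hs; unfold Rmin, Rmax; destruct Rle_dec; lra).
  rewrite <- sg_add by (trivial; lra). f_equal; ring.
Qed.

(** Used twice: it advances the mild solution by one step and, applied to a single power of s,
    isolates the integral over that step in the scheme. *)
Lemma RInt_sg_step (g : R -> X) t tau : (forall s, continuous g s) -> 0 <= t -> 0 <= tau ->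
  RInt (fun s => E (t + tau - s) (g s)) 0 (t + tau) =
  plus (E tau (RInt (fun s => E (t - s) (g s)) 0 t))
    (RInt (fun s => E (t + tau - s) (g s)) t (t + tau)).
Proof.
  intros Hg Ht Htau. rewrite sg_RInt_shift by (trivial; lra). symmetry.
  apply (RInt_Chasles (V := X)); apply sg_ex_RInt; trivial; lra.
Qed.

Lemma continuous_scal_const (k : R -> R) (v : X) s : continuous k s -> continuous (fun s => scal (k s) v) s.
Proof. intros Hk. apply (continuous_scal (V := X)); [exact Hk|apply continuous_const]. Qed.

Lemma continuous_vsum (k : nat -> R -> R) (v : nat -> X) n : (forall j s, continuous (k j) s) ->
  forall s, continuous (fun s => vsum (fun j => scal (k j s) (v j)) n) s.
Proof.
  intros Hk s. induction n as [|n IH]; simpl; [apply continuous_const|].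
  apply (continuous_plus (V := X)); [exact IH|]. apply continuous_scal_const, Hk.
Qed.

Lemma RInt_sg_vsum (k : nat -> R -> R) (v : nat -> X) n a x y :
  (forall j s, continuous (k j) s) -> x <= y <= a ->
  RInt (fun s => E (a - s) (vsum (fun j => scal (k j s) (v j)) n)) x y =
  vsum (fun j => RInt (fun s => E (a - s) (scal (k j s) (v j))) x y) n.
Proof.
  intros Hk Hxy. induction n as [|n IH]; simpl.
  - rewrite (RInt_ext _ (fun _ => zero)).
    + rewrite RInt_const. vring.
    + intros s Hs. apply sg_zero; trivial. revert Hs; unfold Rmin, Rmax; destruct Rle_dec; lra.
  - rewrite <- IH, <- RInt_vplus.
    + apply RInt_ext. intros s Hs. apply sg_plus; trivial.
      revert Hs; unfold Rmin, Rmax; destruct Rle_dec; lra.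
    + apply sg_ex_RInt; trivial. apply continuous_vsum, Hk.
    + apply sg_ex_RInt; trivial. intros s; apply continuous_scal_const, Hk.
Qed.

(** The substitution s = t theta produces the factor t^lam. At t = 0 both sides vanish, by the
    convention on [rpow 0 lam]. *)
Lemma phi_integral lam t v : 1 <= lam -> 0 <= t ->
  scal (Gamma lam) (scal (rpow t lam) (phi E lam t v)) =
  RInt (fun s => E (t - s) (scal (rpow s (lam - 1)) v)) 0 t.
Proof.
  intros Hlam Ht. pose proof (Gamma_pos lam Hlam) as HG.
  destruct (Req_dec t 0) as [->|Hn].
  { rewrite RInt_point, rpow_nonpos by lra. vring. }
  assert (Hc : forall s, continuous (fun s => scal (rpow s (lam - 1)) v) s).
  { intros s; apply continuous_scal_const, continuous_rpow; lra. }
  assert (Hex : ex_RInt (fun s => E (t - s) (scal (rpow s (lam - 1)) v)) 0 t)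
    by (apply sg_ex_RInt; trivial; lra).
  assert (Hlin := RInt_comp_lin (fun s => E (t - s) (scal (rpow s (lam - 1)) v)) t 0 0 1).
  replace (t * 0 + 0) with 0 in Hlin by ring. replace (t * 1 + 0) with t in Hlin by ring.
  rewrite <- (Hlin Hex).
  assert (Hex1 : ex_RInt (fun th => scal (rpow th (lam - 1)) (E ((1 - th) * t) v)) 0 1).
  { apply (ex_RInt_ext (fun th => scal (rpow th (lam - 1)) (E (Rmax 0 (t - t * th)) v))).
    - intros th. rewrite Rmin_left, Rmax_right by lra. intros Hth.
      rewrite Rmax_right by nra. do 2 f_equal. ring.
    - apply (ex_RInt_continuous (V := X)). intros th _.
      apply (continuous_scal (V := X)); [apply continuous_rpow; lra|].
      apply (continuous_comp (fun th => t * th) (fun s => E (Rmax 0 (t - s)) v)).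
      + apply (ex_derive_continuous (K := R_AbsRing) (V := R_NormedModule)). auto_derive; trivial.
      + apply (sg_continuous_extension E HE (fun _ => v) t). intros; apply continuous_const. }
  unfold phi.
  rewrite (RInt_ext (fun y => scal t (E (t - (t * y + 0)) (scal (rpow (t * y + 0) (lam - 1)) v)))
    (fun th => scal (rpow t lam) (scal (rpow th (lam - 1)) (E ((1 - th) * t) v)))).
  - rewrite RInt_vscal by trivial. set (I := RInt _ _ _). vnorm. field; lra.
  - intros th. rewrite Rmin_left, Rmax_right by lra. intros Hth.
    rewrite Rplus_0_r, rpow_mult_l by lra.
    rewrite sg_scal by (trivial; nra).
    replace (t - t * th) with ((1 - th) * t) by ring.
    replace (rpow t lam) with (t * rpow t (lam - 1)).
    + vring.
    + rewrite !rpow_pos by lra. rewrite <- (Rpower_1 t) at 1 by lra.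
      rewrite <- Rpower_plus. f_equal; ring.
Qed.

Lemma vsum_shift (f : nat -> X) n :
  plus (f O) (vsum (fun j => f (S j)) n) = vsum f (S n).
Proof.
  induction n as [|n IH]; [simpl; vring|].
  change (vsum f (S (S n))) with (plus (vsum f (S n)) (f (S n))). rewrite <- IH. simpl. vring.
Qed.

Definition scheme_poly (r : R) (nu : nat) (al : nat -> X) (s : R) : X :=
  vsum (fun j => scal (rpow s (INR j * r)) (al j)) nu.

Lemma INR_mult_nonneg j r : 0 < r -> 0 <= INR j * r.
Proof. intros; apply Rmult_le_pos; [apply pos_INR|lra]. Qed.

Lemma scheme_poly_continuous r nu al s : 0 < r -> continuous (scheme_poly r nu al) s.
Proof.
  intros Hr. apply (continuous_vsum (fun j s => rpow s (INR j * r))).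
  intros j u; apply continuous_rpow, INR_mult_nonneg, Hr.
Qed.

Lemma EQRF_step r nu tau y0 al m : 0 < r -> (1 <= nu)%nat -> 0 <= tau ->
  let t := INR m * tau in
  EQRF E r nu tau y0 al (S m) =
  plus (E tau (EQRF E r nu tau y0 al m))
    (RInt (fun s => E (t + tau - s) (scheme_poly r nu (fun j => al j m) s)) t (t + tau)).
Proof.
  intros Hr Hnu Htau t.
  assert (Ht : 0 <= t) by (apply Rmult_le_pos; [apply pos_INR|trivial]).
  unfold scheme_poly. rewrite (RInt_sg_vsum (fun j s => rpow s (INR j * r))); [|
    intros j s; apply continuous_rpow, INR_mult_nonneg, Hr|lra].
  replace nu with (S (nu - 1)) at 3 by lia. rewrite <- vsum_shift.
  cbn [EQRF]. fold t.
  set (Q := fun j => RInt (fun s => E (t + tau - s) (scal (rpow s (INR j * r)) (al j m))) t (t + tau)).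
  (* The term j = 0 is an integral over [0, tau] in the scheme; its vector is constant, so a shift
     by [t] moves it to [t, t + tau]. *)
  assert (H0 : scal tau (phi E 1 tau (al O m)) = Q O).
  { assert (H := phi_integral 1 tau (al O m) (Rle_refl 1) Htau).
    rewrite Gamma_1 in H.
    assert (Ht1 : rpow tau 1 = tau).
    { destruct (Req_dec tau 0) as [->|Hn]; [apply rpow_nonpos; lra|].
      rewrite rpow_pos by lra. apply Rpower_1; lra. }
    rewrite Ht1 in H. transitivity (scal 1 (scal tau (phi E 1 tau (al O m)))); [vring|].
    rewrite H. unfold Q.
    assert (Hlin := RInt_comp_lin (fun s => E (t + tau - s) (al O m)) 1 t 0 tau).
    replace (1 * 0 + t) with t in Hlin by ring.
    replace (1 * tau + t) with (t + tau) in Hlin by ring.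
    rewrite (RInt_ext (fun s => E (t + tau - s) (scal (rpow s (INR 0 * r)) (al O m)))
      (fun s => E (t + tau - s) (al O m))).
    - rewrite <- Hlin.
      + apply RInt_ext. intros s _. replace (1 - 1) with 0 by ring. rewrite rpow_0_r.
        replace (scal 1 (al O m)) with (al O m) by vring.
        replace (t + tau - (1 * s + t)) with (tau - s) by ring. vring.
      + apply (sg_ex_RInt (fun _ => al O m)); [intros; apply continuous_const|lra].
    - intros s _. simpl INR. rewrite Rmult_0_l, rpow_0_r. f_equal. vring. }
  assert (HS : forall j, scal (Gamma (1 + INR (S j) * r))
      (minus (scal (rpow (t + tau) (1 + INR (S j) * r)) (phi E (1 + INR (S j) * r) (t + tau) (al (S j) m)))
             (scal (rpow t (1 + INR (S j) * r)) (E tau (phi E (1 + INR (S j) * r) t (al (S j) m)))))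
    = Q (S j)).
  { intros j. set (lam := 1 + INR (S j) * r). set (v := al (S j) m).
    assert (Hlam : 1 <= lam) by (unfold lam; pose proof (INR_mult_nonneg (S j) r Hr); lra).
    transitivity (minus (scal (Gamma lam) (scal (rpow (t + tau) lam) (phi E lam (t + tau) v)))
      (E tau (scal (Gamma lam) (scal (rpow t lam) (phi E lam t v))))).
    { vcanon X. rewrite (sg_scal E HE tau (Gamma lam)) by trivial. vcanon X.
      rewrite (sg_scal E HE tau (rpow t lam)) by trivial. vring. }
    assert (Hc : forall s, continuous (fun s => scal (rpow s (lam - 1)) v) s).
    { intros s; apply continuous_scal_const, continuous_rpow; lra. }
    rewrite !phi_integral by (trivial; lra). rewrite RInt_sg_step by trivial.
    set (I := RInt _ 0 t). set (J := RInt _ t (t + tau)).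
    transitivity J; [vring|]. unfold J, Q. unfold lam.
    replace (1 + INR (S j) * r - 1) with (INR (S j) * r) by ring. reflexivity. }
  fold (Q O). rewrite <- H0. rewrite plus_assoc. f_equal.
  apply vsum_ext. intros j _. apply HS.
Qed.

Lemma mild_sol_step h r y0 t tau : (forall s, continuous (fun s => h (rpow s r)) s) ->
  0 <= t -> 0 <= tau ->
  mild_sol E h r y0 (t + tau) =
  plus (E tau (mild_sol E h r y0 t)) (RInt (fun s => E (t + tau - s) (h (rpow s r))) t (t + tau)).
Proof.
  intros Hh Ht Htau. unfold mild_sol.
  rewrite (RInt_sg_step (fun s => h (rpow s r))) by trivial.
  rewrite sg_plus, <- sg_add by trivial. replace (tau + t) with (t + tau) by ring. vring.
Qed.

Definition local_defect h r nu tau (al : nat -> nat -> X) (m : nat) : X :=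
  RInt (fun s => E (INR m * tau + tau - s)
      (minus (h (rpow s r)) (scheme_poly r nu (fun j => al j m) s)))
    (INR m * tau) (INR m * tau + tau).

Fixpoint rsum (f : nat -> R) (n : nat) : R :=
  match n with O => 0 | S k => rsum f k + f k end.

Lemma global_error h r nu tau y0 al T M n (d : nat -> R) :
  (forall s, continuous (fun s => h (rpow s r)) s) -> 0 < r -> (1 <= nu)%nat -> 0 <= tau -> 0 <= M ->
  (forall t v, 0 <= t <= T -> norm (E t v) <= M * norm v) ->
  (forall m, (m < n)%nat -> norm (local_defect h r nu tau al m) <= d m) ->
  INR n * tau <= T ->
  norm (minus (mild_sol E h r y0 (INR n * tau)) (EQRF E r nu tau y0 al n)) <= M * rsum d n.
Proof.
  intros Hh Hr Hnu Htau HM0 HM Hd HT.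
  (* The remaining propagator [E (k tau)] is carried through the induction, so each defect meets the
     bound [M] only once; iterating a one-step bound would give powers of [M]. *)
  assert (Hgen : forall m k, (m <= n)%nat -> (m + k <= n)%nat ->
    norm (E (INR k * tau) (minus (mild_sol E h r y0 (INR m * tau)) (EQRF E r nu tau y0 al m)))
      <= M * rsum d m).
  { induction m as [|m IH]; intros k Hm Hk.
    - simpl INR. rewrite Rmult_0_l. unfold mild_sol. rewrite RInt_point, sg_0 by trivial. simpl.
      replace (minus (plus y0 zero) y0) with (zero : X) by vring.
      assert (Hkt : 0 <= INR k * tau) by (apply Rmult_le_pos; [apply pos_INR|trivial]).
      rewrite sg_zero, norm0 by trivial. lra.
    - assert (Ht : 0 <= INR m * tau) by (apply Rmult_le_pos; [apply pos_INR|trivial]).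
      assert (Hkt : 0 <= INR k * tau) by (apply Rmult_le_pos; [apply pos_INR|trivial]).
      rewrite EQRF_step by trivial. rewrite S_INR.
      replace ((INR m + 1) * tau) with (INR m * tau + tau) by ring.
      rewrite mild_sol_step by trivial.
      set (e := minus (mild_sol E h r y0 (INR m * tau)) (EQRF E r nu tau y0 al m)).
      assert (Hloc : local_defect h r nu tau al m =
        minus (RInt (fun s => E (INR m * tau + tau - s) (h (rpow s r))) (INR m * tau) (INR m * tau + tau))
          (RInt (fun s => E (INR m * tau + tau - s) (scheme_poly r nu (fun j => al j m) s))
            (INR m * tau) (INR m * tau + tau))).
      { unfold local_defect. rewrite <- RInt_vminus.
        - apply RInt_ext. intros s Hs. apply sg_minus; trivial.
          revert Hs; unfold Rmin, Rmax; destruct Rle_dec; lra.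
        - apply (sg_ex_RInt (fun s => h (rpow s r))); [trivial|lra].
        - apply (sg_ex_RInt (scheme_poly r nu (fun j => al j m))); [|lra].
          intros s; apply scheme_poly_continuous, Hr. }
      set (I1 := RInt _ _ _) in Hloc |- *. set (I2 := RInt _ _ _) in Hloc |- *.
      assert (He : minus (plus (E tau (mild_sol E h r y0 (INR m * tau))) I1)
          (plus (E tau (EQRF E r nu tau y0 al m)) I2) = plus (E tau e) (local_defect h r nu tau al m)).
      { rewrite Hloc. unfold e. rewrite sg_minus by trivial. vring. }
      rewrite He, sg_plus, <- sg_add by trivial.
      replace (INR k * tau + tau) with (INR (S k) * tau) by (rewrite S_INR; ring).
      simpl rsum. rewrite Rmult_plus_distr_l. apply norm_plus_le.
      + apply IH; lia.
      + apply Rle_trans with (M * norm (local_defect h r nu tau al m)).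
        * apply HM. split; trivial. apply Rle_trans with (2 := HT).
          apply Rmult_le_compat_r; trivial. apply le_INR; lia.
        * apply Rmult_le_compat_l; trivial. apply Hd; lia. }
  specialize (Hgen n O (le_n _) ltac:(lia)). simpl INR in Hgen at 1.
  rewrite Rmult_0_l, sg_0 in Hgen; trivial.
Qed.

End Scheme.

(** * Step sizes and sums *)

Lemma rpow_lt x y r : 0 < r -> 0 <= x < y -> rpow x r < rpow y r.
Proof.
  intros Hr Hxy. rewrite (rpow_pos y) by lra. destruct (Req_dec x 0) as [->|Hn].
  - rewrite rpow_nonpos by lra. apply exp_pos.
  - rewrite rpow_pos by lra. apply Rlt_Rpower_l; lra.
Qed.

Lemma rpow_le x y r : 0 < r -> 0 <= x <= y -> rpow x r <= rpow y r.
Proof.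
  intros Hr [Hx [Hxy| ->]]; [left; apply rpow_lt; trivial; lra|right; trivial].
Qed.

Lemma Rpower_1_l a : Rpower 1 a = 1.
Proof. unfold Rpower. rewrite ln_1, Rmult_0_r. apply exp_0. Qed.

Lemma Rpower_neg_le x y a : 0 < x <= y -> a <= 0 -> Rpower y a <= Rpower x a.
Proof.
  intros Hxy Ha. replace a with (- - a) by ring. rewrite (Rpower_Ropp y), (Rpower_Ropp x).
  apply Rinv_le_contravar; [apply exp_pos|]. apply Rle_Rpower_l; lra.
Qed.

Lemma Rpower_MVT a x y : 0 < x <= y ->
  exists z, x <= z <= y /\ Rpower y a - Rpower x a = a * Rpower z (a - 1) * (y - x).
Proof.
  intros [Hx [Hxy| ->]].
  - destruct (MVT_cor2 (fun u => Rpower u a) (fun u => a * Rpower u (a - 1)) x y Hxy) as (z & Hz & Hxz).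
    + intros u Hu. apply derivable_pt_lim_power; lra.
    + exists z; split; [lra|exact Hz].
  - exists y; split; [lra|ring].
Qed.

(** The decay m^(-q) of the defects, set to 1 on the first step. *)
Definition weight (q : R) (m : nat) : R :=
  match m with O => 1 | _ => Rpower (INR m) (- q) end.

Lemma weight_pos q m : 0 < weight q m.
Proof. destruct m; [simpl; lra|apply exp_pos]. Qed.

Lemma rsum_mono f n k : (forall m, 0 <= f m) -> (n <= k)%nat -> rsum f n <= rsum f k.
Proof.
  intros Hf H. induction H as [|k H IH]; [lra|]. simpl. specialize (Hf k). lra.
Qed.

Lemma rsum_scal c f n : rsum (fun m => c * f m) n = c * rsum f n.
Proof. induction n as [|n IH]; simpl; [ring|rewrite IH; ring]. Qed.

(** Comparison with the integral of x^(-q) over [1, n], one mean value step at a time; the 2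
    accounts for m = 0 and m = 1. *)
Lemma rsum_weight q n : 0 <= q -> q <> 1 -> (1 <= n)%nat ->
  rsum (weight q) (S n) <= 2 + (Rpower (INR n) (1 - q) - 1) / (1 - q).
Proof.
  intros Hq Hq1 Hn. induction Hn as [|n Hn IH].
  - simpl. rewrite !Rpower_1_l. right; field. lra.
  - change (rsum (weight q) (S (S n))) with (rsum (weight q) (S n) + weight q (S n)).
    assert (H1 : 1 <= INR n) by (apply (le_INR 1); trivial).
    destruct (Rpower_MVT (1 - q) (INR n) (INR (S n))) as (z & Hz & Heq); [rewrite S_INR; lra|].
    assert (Hw : weight q (S n) <= Rpower z (1 - q - 1)).
    { replace (1 - q - 1) with (- q) by ring. apply Rpower_neg_le; lra. }
    replace (INR (S n) - INR n) with 1 in Heq by (rewrite S_INR; ring).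
    replace ((Rpower (INR (S n)) (1 - q) - 1) / (1 - q)) with
      ((Rpower (INR n) (1 - q) - 1) / (1 - q) + Rpower z (1 - q - 1)); [lra|].
    replace (Rpower (INR (S n)) (1 - q)) with
      (Rpower (INR n) (1 - q) + (1 - q) * Rpower z (1 - q - 1)) by lra.
    field; lra.
Qed.

Lemma rsum_weight_1 n : (1 <= n)%nat -> rsum (weight 1) (S n) <= 2 + ln (INR n).
Proof.
  intros Hn. induction Hn as [|n Hn IH].
  - simpl. rewrite Rpower_1_l, ln_1. lra.
  - change (rsum (weight 1) (S (S n))) with (rsum (weight 1) (S n) + weight 1 (S n)).
    assert (H1 : 1 <= INR n) by (apply (le_INR 1); trivial).
    assert (Hl : weight 1 (S n) <= ln (INR (S n)) - ln (INR n)); [|lra].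
    unfold weight. rewrite Rpower_Ropp, Rpower_1 by (apply lt_0_INR; lia).
    destruct (MVT_cor2 ln Rinv (INR n) (INR (S n))) as (z & Hz & Hnz).
    + rewrite S_INR; lra.
    + intros u Hu. apply derivable_pt_lim_ln; lra.
    + rewrite Hz. rewrite S_INR in *. replace (INR n + 1 - INR n) with 1 by ring.
      rewrite Rmult_1_r. apply Rinv_le_contravar; lra.
Qed.

Lemma rsum_weight_bounded q n : 1 < q -> rsum (weight q) n <= 2 + / (q - 1).
Proof.
  intros Hq. apply Rle_trans with (rsum (weight q) (S (S n))).
  - apply rsum_mono; [intros; left; apply weight_pos|lia].
  - apply Rle_trans with (1 := rsum_weight q (S n) ltac:(lra) ltac:(lra) ltac:(lia)).
    pose proof (exp_pos ((1 - q) * ln (INR (S n)))).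
    replace ((Rpower (INR (S n)) (1 - q) - 1) / (1 - q)) with
      (/ (q - 1) - Rpower (INR (S n)) (1 - q) * / (q - 1)) by (field; lra).
    assert (0 < / (q - 1)) by (apply Rinv_0_lt_compat; lra).
    unfold Rpower. nra.
Qed.

Lemma node_prod_bound p l y B : 0 <= B -> (forall i, In i l -> Rabs (y - p i) <= B) ->
  Rabs (node_prod p l y) <= B ^ length l.
Proof.
  intros HB. unfold node_prod. induction l as [|i l IH]; intros H; simpl.
  - rewrite Rabs_R1; lra.
  - rewrite Rabs_mult. apply Rmult_le_compat; try apply Rabs_pos.
    + apply H; left; trivial.
    + apply IH. intros j Hj; apply H; right; trivial.
Qed.

(** Factors are exchanged one at a time: each exchange costs B eta while the other factors stay
    bounded by B, hence the count [length l]. *)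
Lemma node_prod_diff p c l y s B eta : 0 <= B -> 0 <= eta ->
  (forall i, In i l -> Rabs (y - p i) <= B) ->
  (forall i, In i l -> Rabs (s - c i) <= 1) ->
  (forall i, In i l -> Rabs (y - p i - B * (s - c i)) <= B * eta) ->
  Rabs (node_prod p l y - B ^ length l * node_prod c l s) <= INR (length l) * B ^ length l * eta.
Proof.
  intros HB Heta. induction l as [|i l IH]; intros H1 H2 H3.
  - unfold node_prod; simpl. rewrite Rmult_1_r, Rminus_diag, Rabs_R0. lra.
  - specialize (IH (fun j Hj => H1 j (or_intror Hj)) (fun j Hj => H2 j (or_intror Hj))
      (fun j Hj => H3 j (or_intror Hj))).
    assert (Hp := node_prod_bound p l y B HB (fun j Hj => H1 j (or_intror Hj))).
    specialize (H2 i (or_introl eq_refl)). specialize (H3 i (or_introl eq_refl)).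
    assert (HBl : 0 <= B ^ length l) by (apply pow_le; trivial).
    set (P := node_prod p l y) in *. set (Q := node_prod c l s) in *.
    change (node_prod p (i :: l) y) with ((y - p i) * P).
    change (node_prod c (i :: l) s) with ((s - c i) * Q).
    change (length (i :: l)) with (S (length l)). rewrite S_INR.
    change (B ^ S (length l)) with (B * B ^ length l).
    replace ((y - p i) * P - B * B ^ length l * ((s - c i) * Q)) with
      ((y - p i - B * (s - c i)) * P + B * (s - c i) * (P - B ^ length l * Q)) by ring.
    apply Rle_trans with (1 := Rabs_triang _ _).
    replace ((INR (length l) + 1) * (B * B ^ length l) * eta) with
      (B * eta * B ^ length l + B * (INR (length l) * B ^ length l * eta)) by ring.
    apply Rplus_le_compat.
    + rewrite Rabs_mult. apply Rmult_le_compat; trivial; apply Rabs_pos.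
    + rewrite !Rabs_mult, (Rabs_pos_eq B) by trivial.
      apply Rmult_le_compat; trivial; [|apply Rabs_pos|].
      * apply Rmult_le_pos; [trivial|apply Rabs_pos].
      * rewrite <- (Rmult_1_r B) at 2. apply Rmult_le_compat_l; trivial.
Qed.

Lemma continuous_node_prod c l s : continuous (node_prod c l) s.
Proof.
  destruct (node_prod_derivs c l) as (W & H0 & Hd & _).
  apply (continuous_ext (W O)); [exact H0|].
  apply (ex_derive_continuous (K := R_AbsRing) (V := R_NormedModule)). eexists; apply Hd.
Qed.

(** * The image of a time step under s^r *)

Section Steps.
Context (T r tau : R) (nu : nat) (c : nat -> R).
Hypothesis Hr : 0 < r < 1.
Hypothesis Htau : 0 < tau.
Hypothesis Hc : forall i, (i < nu)%nat -> 0 <= c i <= 1.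
Hypothesis Hcinj : forall i j, (i < nu)%nat -> (j < nu)%nat -> i <> j -> c i <> c j.

(** For m >= 1, the first-order length of [t_m^r, t_{m+1}^r]: the derivative of s^r at t_m times
    tau. *)
Definition slope (m : nat) : R := r * Rpower (INR m * tau) (r - 1) * tau.

Lemma step_pos m : (1 <= m)%nat -> 0 < INR m * tau.
Proof. intros; apply Rmult_lt_0_compat; trivial. apply lt_0_INR; lia. Qed.

Lemma step_nonneg m : 0 <= INR m * tau.
Proof. apply Rmult_le_pos; [apply pos_INR|lra]. Qed.

Lemma slope_pos m : 0 < slope m.
Proof. unfold slope. repeat apply Rmult_lt_0_compat; try apply exp_pos; lra. Qed.

Lemma slope_le m : (1 <= m)%nat -> slope m <= Rpower tau r * Rpower (INR m) (r - 1).
Proof.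
  intros Hm. assert (H0 : 0 < INR m) by (apply lt_0_INR; lia).
  unfold slope. rewrite <- Rpower_mult_distr by trivial.
  replace (Rpower tau r) with (Rpower tau (r - 1) * tau).
  - set (u := Rpower (INR m) (r - 1)). set (v := Rpower tau (r - 1)).
    assert (0 < u) by apply exp_pos. assert (0 < v) by apply exp_pos.
    assert (0 < u * v * tau) by (repeat apply Rmult_lt_0_compat; trivial).
    replace (r * (u * v) * tau) with (r * (u * v * tau)) by ring.
    replace (v * tau * u) with (1 * (u * v * tau)) by ring.
    apply Rmult_le_compat_r; lra.
  - rewrite <- (Rpower_1 tau) at 2 by trivial. rewrite <- Rpower_plus. f_equal; ring.
Qed.

Lemma rpow_increment m x y : (1 <= m)%nat -> INR m * tau <= x <= y ->
  rpow y r - rpow x r <= r * Rpower (INR m * tau) (r - 1) * (y - x).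
Proof.
  intros Hm Hxy. pose proof (step_pos m Hm).
  rewrite !rpow_pos by lra. destruct (Rpower_MVT r x y) as (z & Hz & ->); [lra|].
  apply Rmult_le_compat_r; [lra|]. apply Rmult_le_compat_l; [lra|].
  apply Rpower_neg_le; lra.
Qed.

Lemma range_le_slope m : (1 <= m)%nat ->
  rpow (INR m * tau + tau) r - rpow (INR m * tau) r <= slope m.
Proof.
  intros Hm. apply Rle_trans with (1 := rpow_increment m (INR m * tau) (INR m * tau + tau) Hm ltac:(lra)).
  unfold slope. right; ring.
Qed.

(** Two mean value steps bring in the second derivative, at most r t_m^(r-2) in size as 1 - r < 1;
    against the slope this is a relative error tau / t_m = 1/m. *)
Lemma rpow_linearization m x y : (1 <= m)%nat ->
  INR m * tau <= x <= INR m * tau + tau -> INR m * tau <= y <= INR m * tau + tau ->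
  Rabs (rpow y r - rpow x r - slope m * ((y - x) / tau)) <= slope m * / INR m.
Proof.
  intros Hm.
  assert (Hle : forall x y, INR m * tau <= x <= y -> y <= INR m * tau + tau ->
    Rabs (rpow y r - rpow x r - slope m * ((y - x) / tau)) <= slope m * / INR m).
  { clear x y. intros x y Hxy Hy. pose proof (step_pos m Hm) as Ht0.
    assert (Hm0 : 0 < INR m) by (apply lt_0_INR; lia).
    set (t := INR m * tau) in *.
    rewrite !rpow_pos by lra. destruct (Rpower_MVT r x y) as (z & Hz & ->); [lra|].
    destruct (Rpower_MVT (r - 1) t z) as (w & Hw & Heq); [lra|].
    unfold slope. fold t.
    replace (r * Rpower z (r - 1) * (y - x) - r * Rpower t (r - 1) * tau * ((y - x) / tau))
      with (r * ((Rpower z (r - 1) - Rpower t (r - 1)) * (y - x))) by (field; lra).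
    rewrite Heq.
    assert (Hwt : Rpower w (r - 1 - 1) <= Rpower t (r - 1) * / t).
    { apply Rle_trans with (Rpower t (r - 1 - 1)); [apply Rpower_neg_le; lra|].
      right. unfold Rminus at 1. rewrite Rpower_plus, Rpower_Ropp, Rpower_1 by lra. reflexivity. }
    assert (Hw0 : 0 < Rpower w (r - 1 - 1)) by apply exp_pos.
    replace (r * ((r - 1) * Rpower w (r - 1 - 1) * (z - t) * (y - x)))
      with (- (r * ((1 - r) * Rpower w (r - 1 - 1) * (z - t) * (y - x)))) by ring.
    assert (Hprod : 0 <= (z - t) * (y - x) <= tau * tau).
    { split; [apply Rmult_le_pos; lra|apply Rmult_le_compat; lra]. }
    assert (Hfin : 0 <= (1 - r) * Rpower w (r - 1 - 1) * ((z - t) * (y - x))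
      <= Rpower t (r - 1) * / t * (tau * tau)).
    { split.
      - repeat apply Rmult_le_pos; lra.
      - apply Rmult_le_compat; try lra; [apply Rmult_le_pos; lra|]. nra. }
    rewrite Rabs_Ropp, Rabs_pos_eq.
    - replace (r * Rpower t (r - 1) * tau * / INR m) with
        (r * (Rpower t (r - 1) * / t * (tau * tau))) by (unfold t; field; lra).
      apply Rmult_le_compat_l; [lra|]. lra.
    - apply Rmult_le_pos; lra. }
  intros Hx Hy. destruct (Rle_dec x y) as [H|H]; [apply Hle; lra|].
  rewrite <- Rabs_Ropp.
  replace (- (rpow y r - rpow x r - slope m * ((y - x) / tau))) with
    (rpow x r - rpow y r - slope m * ((x - y) / tau)) by (field; lra).
  apply Hle; lra.
Qed.

Definition node (m i : nat) : R := rpow (INR m * tau + c i * tau) r.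

Lemma node_offset i : (i < nu)%nat -> 0 <= c i * tau <= tau.
Proof. intros Hi; specialize (Hc i Hi); nra. Qed.

Lemma node_in m i : (i < nu)%nat ->
  rpow (INR m * tau) r <= node m i <= rpow (INR m * tau + tau) r.
Proof.
  intros Hi; pose proof (node_offset i Hi); pose proof (step_nonneg m).
  split; apply rpow_le; lra.
Qed.

Lemma node_inj m i j : (i < nu)%nat -> (j < nu)%nat -> i <> j -> node m i <> node m j.
Proof.
  intros Hi Hj Hij. pose proof (node_offset i Hi); pose proof (node_offset j Hj).
  pose proof (step_nonneg m). unfold node.
  destruct (total_order_T (c i) (c j)) as [[H'|H']|H'].
  - assert (c i * tau < c j * tau) by (apply Rmult_lt_compat_r; trivial).
    apply Rlt_not_eq, rpow_lt; lra.
  - exfalso. exact (Hcinj i j Hi Hj Hij H').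
  - assert (c j * tau < c i * tau) by (apply Rmult_lt_compat_r; trivial).
    apply Rgt_not_eq, rpow_lt; lra.
Qed.

Lemma tau_slope_pow m : (1 <= m)%nat ->
  tau * slope m ^ nu <= rpow tau (1 + INR nu * r) * weight ((1 - r) * INR nu) m.
Proof.
  intros Hm. assert (H0 : 0 < INR m) by (apply lt_0_INR; lia).
  apply Rle_trans with (tau * (Rpower tau r * Rpower (INR m) (r - 1)) ^ nu).
  - apply Rmult_le_compat_l; [lra|]. apply pow_incr. split; [left; apply slope_pos|apply slope_le, Hm].
  - rewrite Rpow_mult_distr. rewrite <- !Rpower_pow by apply exp_pos.
    rewrite !Rpower_mult, rpow_pos by trivial.
    rewrite Rpower_plus, Rpower_1 by trivial.
    destruct m as [|m]; [lia|]. unfold weight.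
    replace ((r - 1) * INR nu) with (- ((1 - r) * INR nu)) by ring.
    replace (r * INR nu) with (INR nu * r) by ring. right; ring.
Qed.

Lemma tau_range_pow_0 : tau * (rpow (INR 0 * tau + tau) r - rpow (INR 0 * tau) r) ^ nu =
  rpow tau (1 + INR nu * r).
Proof.
  simpl INR. rewrite Rmult_0_l, Rplus_0_l, (rpow_nonpos 0), Rminus_0_r by lra.
  rewrite rpow_rpow_pow, !rpow_pos by lra. rewrite Rpower_plus, Rpower_1; trivial.
Qed.

Lemma tau_range_pow m :
  tau * (rpow (INR m * tau + tau) r - rpow (INR m * tau) r) ^ nu <=
  rpow tau (1 + INR nu * r) * weight ((1 - r) * INR nu) m.
Proof.
  destruct m as [|m].
  - rewrite tau_range_pow_0. simpl. lra.
  - apply Rle_trans with (2 := tau_slope_pow (S m) ltac:(lia)).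
    apply Rmult_le_compat_l; [lra|]. apply pow_incr. split.
    + pose proof (step_nonneg (S m)). apply Rge_le, Rge_minus, Rle_ge, rpow_le; lra.
    + apply range_le_slope; lia.
Qed.

End Steps.

Section ZeroMean.
Context {X : CompleteNormedModule R_AbsRing}.

Lemma is_RInt_scal_vector (g : R -> R) (w : X) a b : (forall s, continuous g s) ->
  is_RInt (fun s => scal (g s) w) a b (scal (RInt g a b) w).
Proof.
  intros Hg.
  assert (Hex : forall a b, ex_RInt g a b)
    by (intros; apply (ex_RInt_continuous (V := R_CompleteNormedModule)); intros; apply Hg).
  replace (scal (RInt g a b) w) with
    (minus (scal (RInt g a b) w) (scal (RInt g a a) w)).
  - apply (is_RInt_derive (V := X) (fun s => scal (RInt g a s) w)).
    + intros s _. assert (H : is_derive (fun s => RInt g a s) s (g s)).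
      { apply (is_derive_RInt g _ a s); [|apply Hg].
        apply filter_forall. intros y. apply (RInt_correct (V := R_CompleteNormedModule)), Hex. }
      exact (is_derive_scal_l (K := R_AbsRing) (V := X) _ s (g s) w H).
    + intros s _. apply continuous_scal_const, Hg.
  - rewrite RInt_point. change (@zero R_CompleteNormedModule) with 0. vring.
Qed.

End ZeroMean.

(** * Local defects and convergence *)

Section Defects.
Context {X : CompleteNormedModule R_AbsRing} (E : R -> X -> X).
Hypothesis HE : C0_semigroup E.
Context (T r tau M : R) (nu : nat) (c : nat -> R) (h : R -> X) (hd : nat -> R -> X).
Hypothesis Hr : 0 < r < 1.
Hypothesis Htau : 0 < tau.
Hypothesis Hnu : (1 <= nu)%nat.
Hypothesis Hc : forall i, (i < nu)%nat -> 0 <= c i <= 1.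
Hypothesis Hcinj : forall i j, (i < nu)%nat -> (j < nu)%nat -> i <> j -> c i <> c j.
Hypothesis Hh : derivs_bdd h nu hd.
Hypothesis HM0 : 0 <= M.
Hypothesis HM : forall t v, 0 <= t <= T -> norm (E t v) <= M * norm v.

Lemma derivs_lipschitz m (g : R -> X) gd k K : derivs_bdd g m gd -> (k < m)%nat ->
  (forall x, 0 <= x -> norm (gd (S k) x) <= K) ->
  forall x y, 0 <= x -> 0 <= y -> norm (minus (gd k y) (gd k x)) <= K * Rabs (y - x).
Proof.
  intros (_ & Hd & _) Hk HK x y Hx Hy.
  apply mean_value_inequality_abs with (gd (S k)) 0 (Rmax x y); try lra;
    try (unfold Rmax; destruct Rle_dec; lra).
  intros z Hz. split; [apply Hd; trivial; lra|apply HK; lra].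
Qed.

(** Continuity holds on the whole line, since [rpow] is continuous with values in [0, oo), where h
    is Lipschitz. *)
Lemma forcing_continuous s : continuous (fun s => h (rpow s r)) s.
Proof.
  destruct Hh as (H0 & _ & Hb). destruct (Hb 1%nat) as [K HK]; [lia|].
  apply continuous_iff_norm. intros e He.
  assert (HK1 : 0 < Rabs K + 1) by (pose proof (Rabs_pos K); lra).
  assert (Hrp : continuous (fun x => rpow x r) s) by (apply continuous_rpow; lra).
  destruct (proj1 (filterlim_locally _ _) Hrp
    (mkposreal (e / (Rabs K + 1)) (Rdiv_lt_0_compat _ _ He HK1))) as [d Hd].
  exists d; split; [apply cond_pos|]. intros y Hy.
  specialize (Hd y Hy). change (Rabs (rpow y r - rpow s r) < e / (Rabs K + 1)) in Hd.
  rewrite <- !H0 by apply rpow_ge_0.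
  apply Rle_lt_trans with (1 := derivs_lipschitz nu h hd O K Hh ltac:(lia) HK _ _
    (rpow_ge_0 s r) (rpow_ge_0 y r)).
  pose proof (Rle_abs K). pose proof (Rabs_pos (rpow y r - rpow s r)).
  apply Rle_lt_trans with ((Rabs K + 1) * Rabs (rpow y r - rpow s r)); [nra|].
  replace e with ((Rabs K + 1) * (e / (Rabs K + 1))) by (field; lra).
  apply Rmult_lt_compat_l; trivial.
Qed.

Definition range (m : nat) : R := rpow (INR m * tau + tau) r - rpow (INR m * tau) r.

Lemma range_nonneg m : 0 <= range m.
Proof.
  unfold range. pose proof (step_nonneg tau Htau m).
  apply Rge_le, Rge_minus, Rle_ge, rpow_le; lra.
Qed.

(** In the variable s^r this is polynomial interpolation on [t_m^r, t_{m+1}^r]; strict monotonicity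
    of s^r keeps the nodes distinct. *)
Lemma local_error m (al : nat -> X) (z : X) K : 0 <= K ->
  (forall i, (i < nu)%nat -> vsum (fun j => scal (rpow (INR m * tau + c i * tau) (INR j * r)) (al j)) nu
    = h (rpow (INR m * tau + c i * tau) r)) ->
  (forall y, rpow (INR m * tau) r <= y <= rpow (INR m * tau + tau) r -> norm (minus (hd nu y) z) <= K) ->
  forall s, INR m * tau <= s <= INR m * tau + tau ->
  norm (minus (minus (h (rpow s r)) (scheme_poly r nu al s))
    (scal (node_prod (node r tau c m) (seq 0 nu) (rpow s r) / INR (fact nu)) z)) <= K * range m ^ nu.
Proof.
  intros HK Hint Hz s Hs. destruct Hh as (H0 & Hd & Hb).
  pose proof (step_nonneg tau Htau m) as Ht.
  rewrite <- H0 by apply rpow_ge_0.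
  replace (scheme_poly r nu al s) with (vsum (fun j => scal (rpow s r ^ j) (al j)) nu).
  2:{ apply vsum_ext. intros j _. rewrite rpow_rpow_pow by lra. reflexivity. }
  apply (interpolation_error nu hd); trivial.
  - split; [apply rpow_ge_0|apply rpow_le; lra].
  - intros i Hi. apply (node_in r tau nu c); trivial.
  - apply (node_inj r tau nu c); trivial.
  - intros i Hi. rewrite H0 by apply rpow_ge_0. unfold node at 2. rewrite <- Hint by trivial.
    apply vsum_ext. intros j _. unfold node. rewrite rpow_rpow_pow by lra. reflexivity.
  - split; apply rpow_le; lra.
Qed.

Lemma local_integrand_continuous (al : nat -> X) s :
  continuous (fun s => minus (h (rpow s r)) (scheme_poly r nu al s)) s.
Proof.
  apply (continuous_minus (V := X)); [apply forcing_continuous|].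
  apply scheme_poly_continuous; lra.
Qed.

Lemma defect_bound m (al : nat -> nat -> X) K : INR m * tau + tau <= T ->
  (forall i, (i < nu)%nat ->
    vsum (fun j => scal (rpow (INR m * tau + c i * tau) (INR j * r)) (al j m)) nu
    = h (rpow (INR m * tau + c i * tau) r)) ->
  (forall x, 0 <= x -> norm (hd nu x) <= K) ->
  norm (local_defect E h r nu tau al m) <=
    M * K * (rpow tau (1 + INR nu * r) * weight ((1 - r) * INR nu) m).
Proof.
  intros HmT Hint HK. pose proof (step_nonneg tau Htau m) as Ht.
  assert (HK0 : 0 <= K) by (apply Rle_trans with (2 := HK 0 (Rle_refl 0)); apply norm_ge_0).
  apply Rle_trans with ((INR m * tau + tau - INR m * tau) * (M * (K * range m ^ nu))).
  - unfold local_defect. apply norm_RInt_bound; [lra| |].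
    + apply (sg_ex_RInt E HE (fun s => minus (h (rpow s r)) (scheme_poly r nu (fun j => al j m) s)));
        [apply local_integrand_continuous|lra].
    + intros s Hs. apply Rle_trans with (1 := HM _ _ (ltac:(lra) : 0 <= INR m * tau + tau - s <= T)).
      apply Rmult_le_compat_l; trivial.
      (* With z = 0 no leading term is split off. *)
      assert (H := local_error m (fun j => al j m) zero K HK0 Hint).
      eapply Rle_trans; [right|apply (H) with (s := s); trivial].
      * f_equal. vring.
      * intros y Hy. norm_as (hd nu y); [vring|]. apply HK.
        pose proof (rpow_ge_0 (INR m * tau) r). lra.
  - replace ((INR m * tau + tau - INR m * tau) * (M * (K * range m ^ nu))) with
      (M * K * (tau * range m ^ nu)) by ring.
    apply Rmult_le_compat_l; [apply Rmult_le_pos; trivial|].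
    apply tau_range_pow; trivial.
Qed.

Lemma zero_mean_rescaled t : RInt (node_prod c (seq 0 nu)) 0 1 = 0 ->
  RInt (fun s => / tau * node_prod c (seq 0 nu) (/ tau * s + - t / tau)) t (t + tau) = 0.
Proof.
  intros H0.
  assert (Hlin := RInt_comp_lin (V := R_CompleteNormedModule) (node_prod c (seq 0 nu)) (/ tau)
    (- t / tau) t (t + tau)).
  replace (/ tau * t + - t / tau) with 0 in Hlin by (field; lra).
  replace (/ tau * (t + tau) + - t / tau) with 1 in Hlin by (field; lra).
  rewrite H0 in Hlin. apply Hlin.
  apply (ex_RInt_continuous (V := R_CompleteNormedModule)). intros; apply continuous_node_prod.
Qed.

Lemma node_prod_continuous_affine k u v s :
  continuous (fun s => k * node_prod c (seq 0 nu) (u * s + v)) s.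
Proof.
  apply (continuous_mult (fun _ => k)); [apply continuous_const|].
  apply (continuous_comp (fun s => u * s + v) (node_prod c (seq 0 nu))).
  - apply (ex_derive_continuous (K := R_AbsRing) (V := R_NormedModule)). auto_derive; trivial.
  - apply continuous_node_prod.
Qed.

(* With [z = h^(nu)(t_m^r)], the leading part of the integrand is [prod_i (s^r - x_i) / nu! z]; its
   linearization at [t_m] has zero mean by the quadrature condition, so it may be subtracted. *)
Lemma defect_bound_superconvergent DA A m (al : nat -> nat -> X) K1 K2 KA :
  (1 <= m)%nat -> 0 < T -> INR m * tau + tau <= T ->
  generator E DA A -> (forall x, 0 <= x -> DA (hd nu x)) ->
  (forall i, (i < nu)%nat ->
    vsum (fun j => scal (rpow (INR m * tau + c i * tau) (INR j * r)) (al j m)) nu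
    = h (rpow (INR m * tau + c i * tau) r)) ->
  (forall x, 0 <= x -> norm (hd nu x) <= K1) ->
  0 <= K2 ->
  (forall x y, 0 <= x -> 0 <= y -> norm (minus (hd nu y) (hd nu x)) <= K2 * Rabs (y - x)) ->
  (forall x, 0 <= x -> norm (A (hd nu x)) <= KA) ->
  RInt (node_prod c (seq 0 nu)) 0 1 = 0 ->
  norm (local_defect E h r nu tau al m) <=
    (M * K2 * Rpower T r + M * KA * T + INR nu * K1) *
      (rpow tau (1 + INR nu * r) * weight ((1 - r) * INR nu + 1) m).
Proof.
  intros Hm HT HmT Hgen HDA Hint HK1 HK20 HK2 HKA Hmean.
  pose proof (step_pos tau Htau m Hm) as Ht.
  assert (Hm0 : 0 < INR m) by (apply lt_0_INR; lia).
  assert (HK10 : 0 <= K1) by (apply Rle_trans with (2 := HK1 0 (Rle_refl 0)); apply norm_ge_0).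
  assert (HKA0 : 0 <= KA) by (apply Rle_trans with (2 := HKA 0 (Rle_refl 0)); apply norm_ge_0).
  set (t := INR m * tau) in *. set (B := slope r tau m).
  assert (HB : 0 < B) by (apply slope_pos; trivial).
  pose proof (range_nonneg m) as HD0.
  assert (HDB : range m <= B) by (apply range_le_slope; trivial).
  (* This and [HtauT] are two of the three sources of the gain 1/m: the variation of h^(nu) over the
     step is at most K2 B, and the semigroup moves z by O(tau). The third is the linearization
     error. *)
  assert (HBT : B <= Rpower T r * / INR m).
  { apply Rle_trans with (1 := slope_le r tau Hr Htau m Hm).
    replace (Rpower tau r * Rpower (INR m) (r - 1)) with (Rpower t r * / INR m).
    - apply Rmult_le_compat_r; [left; apply Rinv_0_lt_compat; trivial|]. apply Rle_Rpower_l; lra.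
    - unfold t. rewrite <- Rpower_mult_distr by trivial.
      unfold Rminus. rewrite Rpower_plus, Rpower_Ropp, Rpower_1 by trivial. ring. }
  assert (HtauT : tau <= T * / INR m).
  { apply (Rmult_le_reg_r (INR m)); trivial. rewrite Rmult_assoc, Rinv_l, Rmult_1_r by lra.
    unfold t in HmT. lra. }
  assert (Hfact : 1 <= INR (fact nu)) by (apply (le_INR 1), lt_O_fact).
  set (x0 := rpow t r). assert (Hx0 : 0 <= x0) by apply rpow_ge_0.
  set (z := hd nu x0).
  set (g := fun s => / tau * node_prod c (seq 0 nu) (/ tau * s + - t / tau)).
  (* Chosen so that [g s * k] is the linearized node product over nu!; the factor tau undoes the
     Jacobian in [g]. *)
  set (k := tau * B ^ nu / INR (fact nu)).
  set (om := fun s => node_prod (node r tau c m) (seq 0 nu) (rpow s r) / INR (fact nu)).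
  set (err := fun s => minus (h (rpow s r)) (scheme_poly r nu (fun j => al j m) s)).
  assert (Hsub : local_defect E h r nu tau al m =
    RInt (fun s => minus (E (t + tau - s) (err s)) (scal (g s) (scal k z))) t (t + tau)).
  { assert (Hg : is_RInt (fun s => scal (g s) (scal k z)) t (t + tau)
      (scal (RInt g t (t + tau)) (scal k z)))
      by (apply is_RInt_scal_vector; intros; apply node_prod_continuous_affine).
    rewrite RInt_vminus.
    - rewrite (is_RInt_unique _ _ _ _ Hg). unfold g at 1. rewrite zero_mean_rescaled by trivial.
      change (local_defect E h r nu tau al m) with (RInt (fun s => E (t + tau - s) (err s)) t (t + tau)).
      vring.
    - apply (sg_ex_RInt E HE err); [apply local_integrand_continuous|lra].
    - eexists; exact Hg. }
  assert (HBn : 0 < B ^ nu) by (apply pow_lt; trivial).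
  assert (Hpt : forall s, t <= s <= t + tau ->
    norm (minus (E (t + tau - s) (err s)) (scal (g s) (scal k z))) <=
    B ^ nu * (M * K2 * Rpower T r + M * KA * T + INR nu * K1) * / INR m).
  { intros s Hs.
    assert (Hnodes : forall i, In i (seq 0 nu) -> (i < nu)%nat) by (intros i Hi; apply in_seq in Hi; lia).
    assert (Hprod : Rabs (node_prod (node r tau c m) (seq 0 nu) (rpow s r)) <= B ^ nu).
    { replace (B ^ nu) with (B ^ length (seq 0 nu)) by (rewrite length_seq; trivial).
      apply node_prod_bound; [lra|]. intros i Hi.
      pose proof (node_in r tau nu c Hr Htau Hc m i (Hnodes i Hi)) as Hin. fold t in Hin.
      assert (rpow t r <= rpow s r <= rpow (t + tau) r) by (split; apply rpow_le; lra).
      unfold range in HDB. fold t in HDB. apply Rabs_le. lra. }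
    assert (Hdiff : Rabs (node_prod (node r tau c m) (seq 0 nu) (rpow s r) -
      B ^ nu * node_prod c (seq 0 nu) ((s - t) / tau)) <= INR nu * B ^ nu * / INR m).
    { assert (Hnd := node_prod_diff (node r tau c m) c (seq 0 nu) (rpow s r) ((s - t) / tau) B (/ INR m)).
      rewrite length_seq in Hnd. apply Hnd; clear Hnd; try lra.
      - left; apply Rinv_0_lt_compat; trivial.
      - intros i Hi.
        pose proof (node_in r tau nu c Hr Htau Hc m i (Hnodes i Hi)) as Hin. fold t in Hin.
        assert (rpow t r <= rpow s r <= rpow (t + tau) r) by (split; apply rpow_le; lra).
        unfold range in HDB. fold t in HDB. apply Rabs_le. lra.
      - intros i Hi. specialize (Hc i (Hnodes i Hi)).
        assert (0 <= (s - t) / tau <= 1).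
        { split; [apply Rdiv_le_0_compat; lra|]. apply (Rmult_le_reg_r tau); trivial.
          unfold Rdiv. rewrite Rmult_assoc, Rinv_l; lra. }
        apply Rabs_le; lra.
      - intros i Hi. pose proof (node_offset tau nu c Htau Hc i (Hnodes i Hi)).
        unfold node. fold t.
        replace ((s - t) / tau - c i) with ((s - (t + c i * tau)) / tau) by (field; lra).
        apply (rpow_linearization r tau Hr Htau); fold t; trivial; lra. }
    assert (Hif : 0 < / INR (fact nu) <= 1).
    { split; [apply Rinv_0_lt_compat; lra|]. rewrite <- Rinv_1. apply Rinv_le_contravar; lra. }
    assert (Hscale : forall u V, Rabs u <= V -> Rabs (u / INR (fact nu)) <= V).
    { intros u V Hu. unfold Rdiv. rewrite Rabs_mult, (Rabs_pos_eq (/ _)) by lra.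
      pose proof (Rabs_pos u). nra. }
    (* Three errors: the interpolation remainder beyond the leading term, the displacement of z by
       the semigroup, and the linearization of the node product. Removing the semigroup from z is
       what leaves a fixed vector times a scalar of zero mean. *)
    norm_as (plus (plus (E (t + tau - s) (minus (err s) (scal (om s) z)))
      (scal (om s) (minus (E (t + tau - s) z) z)))
      (scal (om s - g s * k) z)).
    { assert (Hlin : E (t + tau - s) (minus (err s) (scal (om s) z)) =
        minus (E (t + tau - s) (err s)) (scal (om s) (E (t + tau - s) z))).
      { etransitivity; [apply (sg_minus E HE); lra|]. apply f_equal, (sg_scal E HE). lra. }
      etransitivity; [|apply (f_equal (fun w => plus (plus w _) _)); symmetry; exact Hlin]. vring. }
    replace (B ^ nu * (M * K2 * Rpower T r + M * KA * T + INR nu * K1) * / INR m) with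
      (M * (K2 * (Rpower T r * / INR m) * B ^ nu) + B ^ nu * (M * ((T * / INR m) * KA)) +
       INR nu * B ^ nu * / INR m * K1) by ring.
    apply norm_plus_le; [apply norm_plus_le|].
    - apply Rle_trans with (1 := HM _ _ (ltac:(lra) : 0 <= t + tau - s <= T)).
      apply Rmult_le_compat_l; trivial.
      apply Rle_trans with (K2 * range m * range m ^ nu).
      + apply local_error; trivial; [apply Rmult_le_pos; trivial|].
        fold t. intros y Hy. unfold z. apply Rle_trans with (1 := HK2 x0 y Hx0 ltac:(unfold x0 in *; lra)).
        apply Rmult_le_compat_l; trivial. unfold range. fold t. fold x0.
        rewrite Rabs_pos_eq; unfold x0; lra.
      + apply Rmult_le_compat.
        * apply Rmult_le_pos; trivial.
        * apply pow_le; trivial.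
        * apply Rmult_le_compat_l; lra.
        * apply pow_incr; lra.
    - rewrite norm_scal_R. apply Rmult_le_compat; [apply Rabs_pos|apply norm_ge_0|apply Hscale, Hprod|].
      apply Rle_trans with (1 := sg_generator_bound E HE T M HM0 HM DA A (t + tau - s) z Hgen
        (HDA x0 Hx0) ltac:(lra)).
      apply Rmult_le_compat_l; trivial.
      apply Rmult_le_compat; [lra|apply norm_ge_0|lra|apply HKA, Hx0].
    - rewrite norm_scal_R. apply Rmult_le_compat; [apply Rabs_pos|apply norm_ge_0| |apply HK1, Hx0].
      replace (om s - g s * k) with ((node_prod (node r tau c m) (seq 0 nu) (rpow s r) -
        B ^ nu * node_prod c (seq 0 nu) ((s - t) / tau)) / INR (fact nu)).
      + apply Hscale, Hdiff.
      + unfold om, g, k. replace (/ tau * s + - t / tau) with ((s - t) / tau) by (field; lra).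
        field. split; lra. }
  rewrite Hsub.
  eapply Rle_trans; [apply norm_RInt_bound; [lra| |exact Hpt]|].
  - apply ex_RInt_vminus.
    + apply (sg_ex_RInt E HE err); [apply local_integrand_continuous|lra].
    + eexists. apply is_RInt_scal_vector. intros; apply node_prod_continuous_affine.
  - set (Cd := M * K2 * Rpower T r + M * KA * T + INR nu * K1).
    assert (HCd : 0 <= Cd).
    { unfold Cd. pose proof (exp_pos (r * ln T)). unfold Rpower.
      assert (0 <= M * K2) by (apply Rmult_le_pos; trivial).
      assert (0 <= M * KA) by (apply Rmult_le_pos; trivial).
      pose proof (pos_INR nu).
      assert (0 <= INR nu * K1) by (apply Rmult_le_pos; trivial). nra. }
    assert (Hw : weight ((1 - r) * INR nu + 1) m = weight ((1 - r) * INR nu) m * / INR m).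
    { destruct m as [|m']; [lia|]. unfold weight.
      replace (- ((1 - r) * INR nu + 1)) with (- ((1 - r) * INR nu) + - (1)) by ring.
      rewrite Rpower_plus, (Rpower_Ropp _ 1), Rpower_1 by trivial. reflexivity. }
    rewrite Hw.
    replace ((t + tau - t) * (B ^ nu * Cd * / INR m)) with (Cd * / INR m * (tau * B ^ nu)) by ring.
    set (w := weight _ m). set (p := rpow _ _).
    replace (Cd * (p * (w * / INR m))) with (Cd * / INR m * (p * w)) by ring.
    apply Rmult_le_compat_l; [|apply tau_slope_pow; trivial].
    apply Rmult_le_pos; [trivial|left; apply Rinv_0_lt_compat; trivial].
Qed.

End Defects.

Theorem theorem4 (X : CompleteNormedModule R_AbsRing)
  (E : R -> X -> X) (DA : X -> Prop) (A : X -> X)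
  (T r : R) (y0 : X) (h : R -> X) (nu : nat) (c : nat -> R) :
  C0_semigroup E -> generator E DA A ->
  0 < T -> 0 < r < 1 -> (1 <= nu)%nat ->
  (forall i, (i < nu)%nat -> 0 <= c i <= 1) ->
  (forall i j, (i < nu)%nat -> (j < nu)%nat -> i <> j -> c i <> c j) ->
  ( (exists hd, derivs_bdd h nu hd) ->
    exists C : R, forall N : nat, (0 < N)%nat ->
      let tau := T / INR N in
      forall alpha : nat -> nat -> X, interp_coeffs h r nu c tau alpha N ->
      forall n : nat, (n <= N)%nat ->
        norm (minus (mild_sol E h r y0 (INR n * tau)) (EQRF E r nu tau y0 alpha n))
        <= C * (if Req_EM_T r ((INR nu - 1) / INR nu)
                then tau ^ nu * (1 + Rabs (ln tau))
                else rpow tau (Rmin (1 + INR nu * r) (INR nu))) )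
  /\
  ( (exists hd, derivs_bdd h (S nu) hd /\
       (forall x, 0 <= x -> DA (hd nu x)) /\
       (exists M, forall x, 0 <= x -> norm (A (hd nu x)) <= M)) ->
    RInt (fun s => fold_right Rmult 1 (map (fun i => s - c i) (seq 0 nu))) 0 1 = 0 ->
    exists C : R, forall N : nat, (0 < N)%nat ->
      let tau := T / INR N in
      forall alpha : nat -> nat -> X, interp_coeffs h r nu c tau alpha N ->
      forall n : nat, (n <= N)%nat ->
        norm (minus (mild_sol E h r y0 (INR n * tau)) (EQRF E r nu tau y0 alpha n))
        <= C * rpow tau (1 + INR nu * r) ).
Proof.
  intros HE Hgen HT Hr Hnu Hc Hcinj.
  destruct (sg_bounded E HE T) as (M & HM1 & HM).
  assert (HM0 : 0 <= M) by lra.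
  assert (Hgrid : forall N : nat, (0 < N)%nat -> 0 < INR N /\ 0 < T / INR N /\
    forall m, (m < N)%nat -> INR m * (T / INR N) + T / INR N <= T).
  { intros N HN. assert (HN0 : 0 < INR N) by (apply lt_0_INR; trivial).
    assert (Ht : 0 < T / INR N) by (apply Rdiv_lt_0_compat; trivial).
    split; [trivial|split; trivial]. intros m Hm.
    replace (INR m * (T / INR N) + T / INR N) with (INR (S m) * (T / INR N)) by (rewrite S_INR; ring).
    replace T with (INR N * (T / INR N)) at 2 by (field; lra).
    apply Rmult_le_compat_r; [lra|]. apply le_INR; lia. }
  assert (HnT : forall N n : nat, (0 < N)%nat -> (n <= N)%nat -> INR n * (T / INR N) <= T).
  { intros N n HN Hn. destruct (Hgrid N HN) as (H1 & H2 & _).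
    replace T with (INR N * (T / INR N)) at 2 by (field; lra).
    apply Rmult_le_compat_r; [lra|]. apply le_INR; trivial. }
  assert (Hnu0 : 1 <= INR nu) by (apply (le_INR 1); trivial).
  (* q = 1 is the critical case r = (nu-1)/nu, and q > 1 means 1 + nu r < nu, which decides the
     minimum in the exponent. *)
  set (q := (1 - r) * INR nu).
  assert (Hq : 0 < q) by (apply Rmult_lt_0_compat; lra).
  split.
  - intros (hd & Hh).
    destruct (proj2 (proj2 Hh) nu ltac:(lia)) as [K HK].
    assert (HK0 : 0 <= K) by (apply Rle_trans with (2 := HK 0 (Rle_refl 0)); apply norm_ge_0).
    assert (HMK : 0 <= M * (M * K)) by (repeat apply Rmult_le_pos; trivial).
    assert (Hmain : forall N : nat, (0 < N)%nat -> forall alpha : nat -> nat -> X,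
      interp_coeffs h r nu c (T / INR N) alpha N -> forall n : nat, (n <= N)%nat ->
      norm (minus (mild_sol E h r y0 (INR n * (T / INR N))) (EQRF E r nu (T / INR N) y0 alpha n)) <=
      M * (M * K) * (rpow (T / INR N) (1 + INR nu * r) * rsum (weight q) (S N))).
    { intros N HN al Hal n Hn. destruct (Hgrid N HN) as (HN0 & Htau & Hstep).
      eapply Rle_trans.
      - apply (global_error E HE h r nu (T / INR N) y0 al T M n
          (fun m => M * K * rpow (T / INR N) (1 + INR nu * r) * weight q m)); trivial; try lra.
        + intros s. apply (forcing_continuous r nu h hd); trivial.
        + intros m Hm. rewrite Rmult_assoc.
          apply (defect_bound E HE T r (T / INR N) M nu c h hd); trivial.
          * apply Hstep; lia.
          * intros i Hi. apply Hal; trivial; lia.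
        + apply HnT; trivial.
      - rewrite rsum_scal.
        replace (M * (M * K * rpow (T / INR N) (1 + INR nu * r) * rsum (weight q) n)) with
          (M * (M * K) * (rpow (T / INR N) (1 + INR nu * r) * rsum (weight q) n)) by ring.
        apply Rmult_le_compat_l; trivial. apply Rmult_le_compat_l; [apply rpow_ge_0|].
        apply rsum_mono; [intros; left; apply weight_pos|lia]. }
    assert (Hcomb : forall C0, (forall N : nat, (0 < N)%nat ->
      rpow (T / INR N) (1 + INR nu * r) * rsum (weight q) (S N) <=
      C0 * (if Req_EM_T r ((INR nu - 1) / INR nu)
                then (T / INR N) ^ nu * (1 + Rabs (ln (T / INR N)))
                else rpow (T / INR N) (Rmin (1 + INR nu * r) (INR nu)))) ->
      exists C : R, forall N : nat, (0 < N)%nat ->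
      let tau := T / INR N in
      forall alpha : nat -> nat -> X, interp_coeffs h r nu c tau alpha N ->
      forall n : nat, (n <= N)%nat ->
        norm (minus (mild_sol E h r y0 (INR n * tau)) (EQRF E r nu tau y0 alpha n))
        <= C * (if Req_EM_T r ((INR nu - 1) / INR nu)
                then tau ^ nu * (1 + Rabs (ln tau))
                else rpow tau (Rmin (1 + INR nu * r) (INR nu)))).
    { intros C0 HC0. exists (M * (M * K) * C0). intros N HN tau al Hal n Hn.
      apply Rle_trans with (1 := Hmain N HN al Hal n Hn).
      rewrite (Rmult_assoc _ C0). apply Rmult_le_compat_l; trivial. apply HC0, HN. }
    destruct (Req_EM_T r ((INR nu - 1) / INR nu)) as [Hrq|Hrq].
    + assert (Hq1 : q = 1) by (unfold q; rewrite Hrq; field; lra).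
      assert (Hexp : 1 + INR nu * r = INR nu) by (rewrite Hrq; field; lra).
      (* The sum is at most 2 + ln N, and ln N = ln T - ln tau. *)
      apply (Hcomb (2 + Rabs (ln T))). intros N HN. destruct (Hgrid N HN) as (HN0 & Htau & _).
      rewrite Hexp, rpow_pos, Rpower_pow, Hq1 by trivial.
      assert (HP : 0 < (T / INR N) ^ nu) by (apply pow_lt; trivial).
      replace ((2 + Rabs (ln T)) * ((T / INR N) ^ nu * (1 + Rabs (ln (T / INR N))))) with
        ((T / INR N) ^ nu * ((2 + Rabs (ln T)) * (1 + Rabs (ln (T / INR N))))) by ring.
      apply Rmult_le_compat_l; [lra|].
      apply Rle_trans with (1 := rsum_weight_1 N HN).
      assert (Hln : ln (INR N) = ln T - ln (T / INR N)) by (rewrite ln_div by trivial; ring).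
      rewrite Hln. pose proof (Rle_abs (ln T)). pose proof (Rabs_pos (ln T)).
      pose proof (Rle_abs (- ln (T / INR N))). rewrite Rabs_Ropp in *.
      pose proof (Rabs_pos (ln (T / INR N))). nra.
    + assert (Hq1 : q <> 1).
      { intros H. apply Hrq. unfold q in H. apply (Rmult_eq_reg_r (INR nu)); [|lra].
        unfold Rdiv. rewrite Rmult_assoc, Rinv_l by lra. lra. }
      destruct (Rlt_dec 1 q) as [H1q|H1q].
      * apply (Hcomb (2 + / (q - 1))). intros N HN. destruct (Hgrid N HN) as (HN0 & Htau & _).
        rewrite Rmin_left by (unfold q in H1q; lra).
        rewrite Rmult_comm. apply Rmult_le_compat_r; [apply rpow_ge_0|].
        apply rsum_weight_bounded; trivial.
      (* The sum grows like N^(1-q) = T^(1-q) tau^(-(1-q)), and 1 + nu r - (1 - q) = nu. *)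
      * apply (Hcomb ((2 + / (1 - q)) * Rpower T (1 - q))).
        intros N HN. destruct (Hgrid N HN) as (HN0 & Htau & _).
        rewrite Rmin_right by (unfold q in H1q; lra).
        assert (Hsum : rsum (weight q) (S N) <= (2 + / (1 - q)) * Rpower (INR N) (1 - q)).
        { apply Rle_trans with (1 := rsum_weight q N ltac:(lra) Hq1 HN).
          assert (H1N : 1 <= Rpower (INR N) (1 - q)).
          { apply Rle_trans with (Rpower (INR N) 0); [rewrite Rpower_O by trivial; lra|].
            apply Rle_Rpower; [apply (le_INR 1); trivial|lra]. }
          assert (Hi : 0 < / (1 - q)) by (apply Rinv_0_lt_compat; lra).
          unfold Rdiv. nra. }
        rewrite !rpow_pos by trivial.
        apply Rle_trans with (Rpower (T / INR N) (1 + INR nu * r) *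
          ((2 + / (1 - q)) * Rpower (INR N) (1 - q))).
        { apply Rmult_le_compat_l; [left; apply exp_pos|exact Hsum]. }
        replace (Rpower (T / INR N) (INR nu)) with
          (Rpower (T / INR N) (1 + INR nu * r) * / Rpower (T / INR N) (1 - q)).
        -- replace (Rpower T (1 - q)) with (Rpower (INR N) (1 - q) * Rpower (T / INR N) (1 - q)).
           ++ right. field. split; [apply Rgt_not_eq, exp_pos|lra].
           ++ rewrite Rpower_mult_distr by trivial. f_equal. field; lra.
        -- rewrite <- Rpower_Ropp, <- Rpower_plus. f_equal. unfold q; ring.
  - intros (hd & Hh1 & HDA & (KA & HKA)) Hmean.
    assert (Hh : derivs_bdd h nu hd).
    { destruct Hh1 as (H0 & Hd & Hb). split; [trivial|split].
      - intros k x Hk; apply Hd; lia.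
      - intros k Hk; apply Hb; lia. }
    destruct (proj2 (proj2 Hh) nu ltac:(lia)) as [K1 HK1].
    destruct (proj2 (proj2 Hh1) (S nu) ltac:(lia)) as [K2 HK2].
    assert (HK10 : 0 <= K1) by (apply Rle_trans with (2 := HK1 0 (Rle_refl 0)); apply norm_ge_0).
    assert (HK20 : 0 <= K2) by (apply Rle_trans with (2 := HK2 0 (Rle_refl 0)); apply norm_ge_0).
    assert (HKA0 : 0 <= KA) by (apply Rle_trans with (2 := HKA 0 (Rle_refl 0)); apply norm_ge_0).
    set (C1 := M * K2 * Rpower T r + M * KA * T + INR nu * K1).
    assert (HMK : 0 <= M * K1) by (apply Rmult_le_pos; trivial).
    assert (HC1 : 0 <= C1).
    { unfold C1. assert (0 < Rpower T r) by apply exp_pos.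
      assert (0 <= M * K2) by (apply Rmult_le_pos; trivial).
      assert (0 <= M * KA) by (apply Rmult_le_pos; trivial).
      assert (0 <= INR nu * K1) by (apply Rmult_le_pos; lra). nra. }
    (* [M * K1] serves the first step and [C1] the later ones; [2 + / q] bounds the sum of the
       weights of exponent q + 1. *)
    exists (M * (M * K1 + C1) * (2 + / q)).
    intros N HN tau al Hal n Hn. destruct (Hgrid N HN) as (HN0 & Htau & Hstep).
    fold tau in Htau, Hstep. set (S0 := rpow tau (1 + INR nu * r)).
    assert (HS0 : 0 <= S0) by apply rpow_ge_0.
    eapply Rle_trans.
    + apply (global_error E HE h r nu tau y0 al T M n
        (fun m => (M * K1 + C1) * S0 * weight (q + 1) m)); trivial; try lra.
      * intros s. apply (forcing_continuous r nu h hd); trivial.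
      * intros m Hm.
        assert (Hi : forall i, (i < nu)%nat ->
          vsum (fun j => scal (rpow (INR m * tau + c i * tau) (INR j * r)) (al j m)) nu
          = h (rpow (INR m * tau + c i * tau) r)) by (intros i Hi; apply Hal; trivial; lia).
        rewrite Rmult_assoc.
        assert (Hw : 0 <= S0 * weight (q + 1) m)
          by (apply Rmult_le_pos; [trivial|left; apply weight_pos]).
        destruct m as [|m].
        (* At t_0 = 0 there is nothing to linearize; [weight] is 1 there for every exponent, so the
           plain bound suffices. *)
        -- apply Rle_trans with (M * K1 * (S0 * weight q 0)).
           ++ apply (defect_bound E HE T r tau M nu c h hd); trivial. apply Hstep; lia.
           ++ simpl weight. rewrite Rmult_1_r. apply Rmult_le_compat_r; lra.
        -- apply Rle_trans with (C1 * (S0 * weight (q + 1) (S m))).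
           ++ apply (defect_bound_superconvergent E HE T r tau M nu c h hd) with (DA := DA) (A := A); trivial.
              ** lia.
              ** apply Hstep; lia.
              ** apply (derivs_lipschitz (S nu) h); trivial; lia.
           ++ apply Rmult_le_compat_r; lra.
      * apply HnT; trivial.
    + rewrite rsum_scal.
      replace (M * ((M * K1 + C1) * S0 * rsum (weight (q + 1)) n)) with
        (M * (M * K1 + C1) * rsum (weight (q + 1)) n * S0) by ring.
      apply Rmult_le_compat_r; trivial. apply Rmult_le_compat_l; [apply Rmult_le_pos; lra|].
      assert (Hb := rsum_weight_bounded (q + 1) n ltac:(lra)).
      replace (q + 1 - 1) with q in Hb by ring. exact Hb.
Qed.
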